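(* Let $r\ge 1$. Let $E=\{e_i\}_{i=1}^N$ ($N\le\infty$) be a $1$-unconditional basic sequence in $L_1=L_1([0,1],\lambda)$ which is $r$-concave with constant $K_1$. Let $\mu$ be a probability measure on $[0,1]$ and let $X$ be a subspace of $L_1([0,1],\mu)$ such that $\|x\|_{L_r([0,1],\mu)}\le K_2\|x\|_{L_1([0,1],\mu)}$ for all $x\in X$. Then $(\sum\bigoplus X)_E$ embeds isomorphically into $L_1$, i.e. there is a linear map $T:(\sum\bigoplus X)_E\to L_1$ and constants $a,b>0$ with $b/a\le C$ such that $a\|x\|\le\|Tx\|_{L_1}\le b\|x\|$ for all $x$, where $C$ depends only on $K_1$, $K_2$ and $r$. Consequently, if $1\le r<p\le 2$ and $E=\{e_i\}$ and $F=\{f_i\}$ are two $1$-unconditional basic sequences in $L_1$ with $E$ $r$-concave with constant $K_1$ and $F$ $p$-convex with constant $K_2$, then the space $E(F)$ of matrices $A=\{a_{k,l}\}$ with norm \[ \|A\|_{E(F)}=\Big\|\sum_k \Big\|\sum_l a_{k,l}f_l\Big\|_{L_1}\,e_k\Big\|_{L_1} \] embeds isomorphically into $L_1$ with isomorphism constant depending only on $r,p,K_1$ and $K_2$.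
   Context: $L_p$ denotes $L_p([0,1],\lambda)$ with $\lambda$ Lebesgue measure. A basis/basic sequence $\{e_i\}$ (finite or infinite) is $1$-unconditional if $\|\sum_i a_ie_i\|\le\|\sum_i b_ie_i\|$ whenever $|a_i|=|b_i|$ for all $i$. For $x=\sum_j x(j)e_j$ in the span of $\{e_j\}$ and $\alpha>0$, write $|x|^\alpha=\sum_j|x(j)|^\alpha e_j$ (and similarly $(\sum_i|x_i|^\alpha)^{1/\alpha}=\sum_j(\sum_i|x_i(j)|^\alpha)^{1/\alpha}e_j$). A $1$-unconditional basic sequence $\{e_i\}$ is $p$-convex with constant $K$ if for all $n$ and all $x_1,\dots,x_n$ in its span, $\|(\sum_{i=1}^n|x_i|^p)^{1/p}\|\le K(\sum_{i=1}^n\|x_i\|^p)^{1/p}$; it is $r$-concave with constant $K$ if for all such $x_1,\dots,x_n$, $(\sum_{i=1}^n\|x_i\|^r)^{1/r}\le K\|(\sum_{i=1}^n|x_i|^r)^{1/r}\|$. For a $1$-unconditional basic sequence $E=\{e_i\}$ and a Banach space $X$, $(\sum\bigoplus X)_E$ is the space of sequences $x=(x_1,x_2,\dots)$ with $x_i\in X$ for which the norm $\|x\|=\|\sum_i\|x_i\|_X e_i\|$ is finite. *)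

(* Defs.v *)
From HB Require Import structures.
From mathcomp Require Import all_boot all_order all_algebra.
From mathcomp Require Import all_classical all_reals all_analysis.
Set Implicit Arguments. Unset Strict Implicit. Unset Printing Implicit Defensive.
Import Order.TTheory GRing.Theory Num.Theory.
Local Open Scope classical_set_scope.
Local Open Scope ring_scope.

(* Index range of a (finite or infinite) sequence {e_i}_{i < N}, N <= oo:
   [None] means N = oo, [Some n] means the indices 0 .. n-1. *)
Definition inN (N : option nat) (i : nat) : bool :=
  if N is Some n then (i < n)%N else true.

Definition isL1 {R : realType} (f : R -> R) : Prop :=
  measurable_fun (`[0%R, 1%R]%classic : set R) f /\
  (@lebesgue_measure R).-integrable (`[0%R, 1%R]%classic : set R) (EFin \o f).

Definition L1norm {R : realType} (f : R -> R) : R :=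
  fine (\int[@lebesgue_measure R]_(x in (`[0%R, 1%R]%classic : set R)) (`|f x|)%:E).

Definition psum {R : realType} (N : option nat) (c : nat -> R)
  (e : nat -> R -> R) (n : nat) : R -> R :=
  fun t => \sum_(i < n | inN N i) c i * e i t.

Definition series_to {R : realType} (N : option nat) (c : nat -> R)
  (e : nat -> R -> R) (g : R -> R) : Prop :=
  isL1 g /\ (fun n => L1norm (g \- psum N c e n)) @ \oo --> 0.

Definition in_cspan {R : realType} (N : option nat) (e : nat -> R -> R)
  (x : R -> R) : Prop :=
  isL1 x /\ forall eps : R, 0 < eps ->
    exists (c : nat -> R) (n : nat), L1norm (x \- psum N c e n) < eps.

Definition basic_seq {R : realType} (N : option nat) (e : nat -> R -> R) : Prop :=
  (forall i, inN N i -> isL1 (e i)) /\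
  forall x, in_cspan N e x ->
    exists c : nat -> R, series_to N c e x /\
      forall c' : nat -> R, series_to N c' e x -> forall i, inN N i -> c' i = c i.

Definition one_unconditional {R : realType} (N : option nat)
  (e : nat -> R -> R) : Prop :=
  forall (n : nat) (a b : nat -> R),
    (forall i, inN N i -> `|a i| = `|b i|) ->
    L1norm (psum N a e n) <= L1norm (psum N b e n).

Definition r_concave {R : realType} (N : option nat) (e : nat -> R -> R)
  (r K : R) : Prop :=
  forall (n m : nat) (a : 'I_n -> nat -> R),
    (\sum_(k < n) L1norm (psum N (a k) e m) `^ r) `^ r^-1
      <= K * L1norm (psum N (fun j => (\sum_(k < n) `|a k j| `^ r) `^ r^-1) e m).

Definition p_convex {R : realType} (N : option nat) (e : nat -> R -> R)
  (p K : R) : Prop :=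
  forall (n m : nat) (a : 'I_n -> nat -> R),
    L1norm (psum N (fun j => (\sum_(k < n) `|a k j| `^ p) `^ p^-1) e m)
      <= K * (\sum_(k < n) L1norm (psum N (a k) e m) `^ p) `^ p^-1.

Definition L1mu_subspace {R : realType} (mu : probability R R)
  (X : set (R -> R)) : Prop :=
  X (fun _ => 0) /\
  (forall x y (al be : R), X x -> X y -> X (fun t => al * x t + be * y t)) /\
  (forall x, X x -> measurable_fun setT x /\ mu.-integrable setT (EFin \o x)).

Definition L1mu {R : realType} (mu : probability R R) (f : R -> R) : R :=
  fine ('N[mu]_1[EFin \o f])%E.

Definition sumspace_norm {R : realType} (N : option nat) (e : nat -> R -> R)
  (mu : probability R R) (x : nat -> R -> R) (v : R) : Prop :=
  exists g, series_to N (fun i => L1mu mu (x i)) e g /\ v = L1norm g.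

Definition in_sumspace {R : realType} (N : option nat) (e : nat -> R -> R)
  (mu : probability R R) (X : set (R -> R)) (x : nat -> R -> R) : Prop :=
  (forall i, inN N i -> X (x i)) /\ (forall i, ~~ inN N i -> x i = (fun _ => 0)) /\
  exists v, sumspace_norm N e mu x v.

Definition lin_seq {R : realType} (al : R) (x : nat -> R -> R) (be : R)
  (y : nat -> R -> R) : nat -> R -> R :=
  fun i t => al * x i t + be * y i t.

Definition EF_norm {R : realType} (NE : option nat) (e : nat -> R -> R)
  (NF : option nat) (f : nat -> R -> R) (A : nat -> nat -> R) (v : R) : Prop :=
  exists rows : nat -> R -> R,
    (forall k, inN NE k -> series_to NF (A k) f (rows k)) /\
    exists h, series_to NE (fun k => L1norm (rows k)) e h /\ v = L1norm h.

Definition in_EF {R : realType} (NE : option nat) (e : nat -> R -> R)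
  (NF : option nat) (f : nat -> R -> R) (A : nat -> nat -> R) : Prop :=
  (forall k l, ~~ (inN NE k && inN NF l) -> A k l = 0) /\
  exists v, EF_norm NE e NF f A v.

Definition lin_mat {R : realType} (al : R) (A : nat -> nat -> R) (be : R)
  (B : nat -> nat -> R) : nat -> nat -> R :=
  fun k l => al * A k l + be * B k l.

(* The normed space (S, nrm) embeds isomorphically into L_1 with isomorphism
   constant at most C: a linear T : S -> L_1 (linear up to a.e. equality,
   as elements of L_1 are classes) and a, b > 0 with b / a <= C and
   a ||x|| <= ||T x||_{L_1} <= b ||x||. *)
Definition embeds_L1 {R : realType} {V : Type} (S : set V)
  (lin : R -> V -> R -> V -> V) (nrm : V -> R -> Prop) (C : R) : Prop :=
  exists (T : V -> R -> R) (a b : R),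
    0 < a /\ 0 < b /\ b / a <= C /\
    (forall x, S x -> isL1 (T x)) /\
    (forall x y (al be : R), S x -> S y ->
       {ae @lebesgue_measure R, forall t, (`[0%R, 1%R]%classic : set R) t ->
          T (lin al x be y) t = al * T x t + be * T y t}) /\
    (forall x v, S x -> nrm x v -> a * v <= L1norm (T x) <= b * v).

(* Main.v *)
Require Import Defs.
From HB Require Import structures.
From mathcomp Require Import all_boot all_order all_algebra.
From mathcomp Require Import all_classical all_reals all_analysis.
From mathcomp Require Import measurable_realfun ring lra zify.
Import Order.TTheory GRing.Theory Num.Theory.
Import numFieldNormedType.Exports.
Local Open Scope classical_set_scope.
Local Open Scope ring_scope.
Set Implicit Arguments. Unset Strict Implicit. Unset Printing Implicit Defensive.

(* Part 1. On [0,1] x [0,1] with the measure lambda x mu, put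
   T x (s, t) = sum_i e_i(s) x_i(t).  Integrating first in t and using the
   triangle inequality gives ||T x|| >= ||x||; integrating first in s, the
   r-concavity of E, extended from finite sums to integrals, bounds ||T x|| by
   K1 times the norm with ||x_i||_{L_r(mu)} in place of ||x_i||_{L_1(mu)}.
   A Borel injection of the plane into the line followed by a quantile map
   realises lambda x mu as an image of lambda.

   Part 2. The argument only uses that, after a change of density
   x |-> x / w, w dlambda, the L_r and L_1 norms of the x_i are comparable, so
   it remains to find w for the span of F.  Averaging over signs and
   Khintchine's inequality turn p-convexity into
   ||max_k |y_k||| <= C (sum_k ||y_k||^p)^{1/p}, hence
   ||max_k |y_k||| - sum_k ||y_k||^p is bounded over finite families.  Almost
   maximising families increase to a function G such that
   int (|x| - G)^+ <= ||x||^p for all x in the span.  Applied to the multiples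
   2^{1-j} x / ||x||, this bounds the part of |x| above 2^{j-1} ||x|| G; since
   r < p the dyadic pieces sum to the required L_r bound relative to
   w = max(G, 0) + 1. *)

(** * The space L1 *)

(** Adjoining x to a family with pointwise maximum g raises the norm of the maximum by int (|x| -
    g)^+ and the cost by ||x||^p. Near-maximality of the difference is therefore an excess bound, up
    to an error that vanishes along the families. The difference is bounded because the maximal
    inequality controls the norm by a power 1/p < 1 of the cost; here p > 1 enters. The outcome is a
    change of density in the manner of Nikishin and Maurey: relative to w it is only a weak type p
    estimate, which is why p has to drop to r.

    The triangle inequality in t only produces the integrals of the x_i; unconditionality, by
    passing to |x_i|, produces their norms.

    Both parts are instances of [embeds_tens], with w = 1 in Part 1. All estimates concern finite
    sums, with constants independent of their length, and the embedding is an L1 limit. As elements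
    of L1 are represented by functions, limits are chosen representatives and identities between
    them hold almost everywhere. *)

Section L1_basics.
Context {R : realType}.
Local Notation I01 := (`[0%R, 1%R]%classic : set R).
Local Notation lam := (@lebesgue_measure R).
Implicit Types f g h : R -> R.

Lemma measurable_I01 : measurable (I01 : set (measurableTypeR R)).
Proof. exact: measurable_itv. Qed.
Hint Resolve measurable_I01 : core.

Lemma isL1P f : isL1 f <-> lam.-integrable I01 (EFin \o f).
Proof.
split=> [[]//|fi]; split=> //; apply/measurable_EFinP.
exact: measurable_int fi.
Qed.

Lemma L1normE f : L1norm f = \int[lam]_(x in I01) `|f x|.
Proof. by []. Qed.

Lemma isL1_norm f : isL1 f -> lam.-integrable I01 (EFin \o (Num.norm \o f)).
Proof. by move=> [_ fi]; exact: integrable_norm. Qed.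

Lemma EFin_L1norm f : isL1 f ->
  (L1norm f)%:E = (\int[lam]_(x in I01) (`|f x|)%:E)%E.
Proof.
move=> /isL1_norm fi; rewrite /L1norm fineK//; exact: integrable_fin_num.
Qed.

Lemma isL1_lin a f b g : isL1 f -> isL1 g -> isL1 (fun t => a * f t + b * g t).
Proof.
move=> /isL1P fi /isL1P gi; apply/isL1P.
have := integrableD measurable_I01 (integrableZl measurable_I01 a fi)
  (integrableZl measurable_I01 b gi).
by apply: eq_integrable => // x _ /=; rewrite EFinD !EFinM.
Qed.

Lemma eq_isL1 f g : f =1 g -> isL1 f -> isL1 g.
Proof. by move=> /funext ->. Qed.

Lemma isL10 : isL1 (fun _ : R => 0 : R).
Proof. by apply/isL1P; exact: integrable0. Qed.

Lemma isL1Z a f : isL1 f -> isL1 (fun t => a * f t).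
Proof.
move=> fi; apply: eq_isL1 (isL1_lin a 0 fi isL10) => t /=.
by rewrite mulr0 addr0.
Qed.

Lemma isL1D f g : isL1 f -> isL1 g -> isL1 (fun t => f t + g t).
Proof.
move=> fi gi; apply: eq_isL1 (isL1_lin 1 1 fi gi) => t /=.
by rewrite !mul1r.
Qed.

Lemma isL1B f g : isL1 f -> isL1 g -> isL1 (f \- g).
Proof.
move=> fi gi; apply: eq_isL1 (isL1_lin 1 (-1) fi gi) => t /=.
by rewrite !mul1r mulN1r.
Qed.

Lemma isL1_sum (I : Type) (s : seq I) (P : pred I) (F : I -> R -> R) :
  (forall i, P i -> isL1 (F i)) -> isL1 (fun t => \sum_(i <- s | P i) F i t).
Proof.
move=> Fi; elim: s => [|i s IH].
  by apply: eq_isL1 isL10 => t; rewrite big_nil.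
case Pi: (P i); last by apply: eq_isL1 IH => t; rewrite big_cons Pi.
by apply: eq_isL1 (isL1D (Fi _ Pi) IH) => t; rewrite big_cons Pi.
Qed.

Lemma isL1_le f g : measurable_fun I01 f -> isL1 g ->
  (forall t, I01 t -> `|f t| <= `|g t|) -> isL1 f.
Proof.
move=> mf /isL1P gi fg; apply/isL1P; apply: le_integrable gi => //.
  exact/measurable_EFinP.
Qed.

Lemma isL1_abs f : isL1 f -> isL1 (fun t => `|f t|).
Proof. by move=> /isL1_norm fi; exact/isL1P. Qed.

Lemma isL1_maxr f g : isL1 f -> isL1 g -> isL1 (fun t => Num.max (f t) (g t)).
Proof.
move=> fi gi.
apply: isL1_le (isL1D (isL1_abs fi) (isL1_abs gi)) _ => /=.
  by apply: measurable_maxr; [case: fi|case: gi].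
move=> t _; rewrite [leRHS]ger0_norm ?addr_ge0//.
by rewrite maxEle; case: ifP => _; rewrite ?lerDl ?lerDr.
Qed.

Lemma isL1_cst a : isL1 (fun _ : R => a).
Proof.
apply/isL1P; apply/integrableP; split.
  exact/measurable_EFinP.
by rewrite integral_cst//= lebesgue_measure_itv/= lte_fin ltr01 -EFinD -EFinM ltry.
Qed.

Lemma L1norm_ge0 f : 0 <= L1norm f.
Proof. by rewrite L1normE; exact: Rintegral_ge0. Qed.

Lemma L1norm_abs f : L1norm (fun t => `|f t|) = L1norm f.
Proof. by rewrite !L1normE; apply: eq_Rintegral => t _; rewrite normr_id. Qed.

Lemma L1norm_le f g : isL1 f -> isL1 g ->
  (forall t, I01 t -> `|f t| <= `|g t|) -> L1norm f <= L1norm g.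
Proof.
move=> fi gi fg; rewrite !L1normE; apply: le_Rintegral => //; exact: isL1_norm.
Qed.

Lemma L1normD f g : isL1 f -> isL1 g ->
  L1norm (fun t => f t + g t) <= L1norm f + L1norm g.
Proof.
move=> fi gi; rewrite !L1normE -RintegralD//; [|exact: isL1_norm..].
apply: le_Rintegral => //.
- exact: isL1_norm (isL1D fi gi).
- by have /isL1P := isL1D (isL1_abs fi) (isL1_abs gi).
- by move=> t _; exact: ler_normD.
Qed.

Lemma L1normZ a f : isL1 f -> L1norm (fun t => a * f t) = `|a| * L1norm f.
Proof.
move=> fi; rewrite !L1normE -RintegralZl//; last exact: isL1_norm.
by apply: eq_Rintegral => t _; rewrite normrM.
Qed.

Lemma eq_L1norm f g : {in I01, f =1 g} -> L1norm f = L1norm g.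
Proof. by move=> fg; rewrite !L1normE; apply: eq_Rintegral => t It; rewrite fg. Qed.

Lemma L1norm0 : L1norm (fun _ : R => 0 : R) = 0.
Proof.
rewrite L1normE /Rintegral; under eq_integral do rewrite normr0.
by rewrite integral0.
Qed.

Lemma L1norm_sub f g : L1norm (f \- g) = L1norm (g \- f).
Proof. by rewrite !L1normE; apply: eq_Rintegral => t _; rewrite distrC. Qed.

Lemma L1norm_triB f g h : isL1 f -> isL1 g -> isL1 h ->
  L1norm (f \- h) <= L1norm (f \- g) + L1norm (g \- h).
Proof.
move=> fi gi hi; have := L1normD (isL1B fi gi) (isL1B gi hi); congr (_ <= _).
by apply: eq_L1norm => t _ /=; ring.
Qed.

Lemma L1norm_sub_le f g : isL1 f -> isL1 g ->
  L1norm f <= L1norm g + L1norm (f \- g).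
Proof.
move=> fi gi; have := L1normD gi (isL1B fi gi); congr (_ <= _).
by apply: eq_L1norm => t _ /=; ring.
Qed.

Lemma L1norm_sum (I : Type) (s : seq I) (P : pred I) (F : I -> R -> R) :
  (forall i, P i -> isL1 (F i)) ->
  L1norm (fun t => \sum_(i <- s | P i) F i t) <= \sum_(i <- s | P i) L1norm (F i).
Proof.
move=> Fi; elim: s => [|i s IH].
  rewrite big_nil (@eq_L1norm _ (fun=> 0)) ?L1norm0// => t _; by rewrite big_nil.
rewrite big_cons; case: ifPn => Pi; last first.
  by rewrite (@eq_L1norm _ (fun t => \sum_(i <- s | P i) F i t))// => t _;
    rewrite big_cons (negbTE Pi).
rewrite (@eq_L1norm _ (fun t => F i t + \sum_(i <- s | P i) F i t)); last first.
  by move=> t _; rewrite big_cons Pi.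
apply: le_trans (L1normD _ _) _; [exact: Fi|exact: isL1_sum|].
by rewrite lerD2l.
Qed.

Lemma ae_lebesgueS (P Q : R -> Prop) : (forall t, P t -> Q t) ->
  {ae lam, forall t, P t} -> {ae lam, forall t, Q t}.
Proof. by move=> PQ; apply: (@filterS _ (nbhs (almost_everywhere lam))). Qed.

Lemma L1norm_eq0_ae f : isL1 f -> L1norm f = 0 ->
  {ae lam, forall t, I01 t -> f t = 0}.
Proof.
move=> fi f0; have [mf _] := fi.
have : (\int[lam]_(x in I01) `|(f x)%:E| = 0)%E.
  by have := EFin_L1norm fi; rewrite f0.
move/(ae_eq_integral_abs lam measurable_I01 (proj2 (measurable_EFinP _ _) mf)).
by apply: ae_lebesgueS => t + It => /(_ It)[].
Qed.

End L1_basics.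

(** Fatou's lemma for almost everywhere limits: [f] agrees almost everywhere with the lower limit of
    [fs], so a uniform bound on the integrals survives without a dominating function. *)
Lemma ge0_integral_cvg_le d (T : measurableType d) (R : realType)
    (mu : {measure set T -> \bar R}) (D : set T) (fs : nat -> T -> \bar R)
    (f : T -> \bar R) (B : \bar R) :
  measurable D -> (forall n, measurable_fun D (fs n)) ->
  measurable_fun D f -> (forall n t, D t -> (0 <= fs n t)%E) ->
  (forall t, D t -> (0 <= f t)%E) ->
  {ae mu, forall t, D t -> fs ^~ t @ \oo --> f t} ->
  (forall n, \int[mu]_(t in D) fs n t <= B)%E -> (\int[mu]_(t in D) f t <= B)%E.
Proof.
move=> mD mfs mf fs0 f0 cv fsB.
have meq : measurable_fun D (fun t => limn_einf (fs ^~ t)).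
  apply: (@emeasurable_fun_cvg _ _ _ _ (fun n t => einfs (fs ^~ t) n)).
    exact: measurable_fun_einfs.
  by move=> t _; rewrite limn_einf_lim; exact: is_cvg_einfs.
have -> : (\int[mu]_(t in D) f t = \int[mu]_(t in D) limn_einf (fs ^~ t))%E.
  apply: ae_eq_integral => //; move: cv; apply: filterS => t + Dt => /(_ Dt) cv.
  have cvt : cvgn (fs ^~ t) by apply/cvg_ex; exists (f t).
  by rewrite is_cvg_limn_einfE//; apply/esym/cvg_lim.
apply: le_trans (fatou mu mD mfs fs0) _.
rewrite limn_einf_lim; apply: lime_le; first exact: is_cvg_einfs.
apply: nearW => n; apply: le_trans (fsB n).
by apply: ereal_inf_lbound; exists n => /=.
Qed.

(** * Completeness of L1 and limits of partial sums *)

Section L1_complete.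
Context {R : realType}.
Local Notation I01 := (`[0%R, 1%R]%classic : set R).
Local Notation lam := (@lebesgue_measure R).

Lemma sum_half_le (n : nat) : \sum_(j < n) (2^-1 : R) ^+ j <= 2.
Proof.
suff -> : \sum_(j < n) (2^-1 : R) ^+ j = 2 - 2 * 2^-1 ^+ n.
  by rewrite gerBl mulr_ge0// exprn_ge0.
elim: n => [|n IH]; first by rewrite big_ord0 expr0; lra.
by rewrite big_ord_recr/= IH exprS; lra.
Qed.

(** Riesz-Fischer: along a subsequence with consecutive distances at most 2^-j, the sum [H] of the
    absolute increments is integrable, hence finite almost everywhere, and the subsequence converges
    there. Fatou turns this into L1 convergence of the whole sequence. *)
Lemma L1_complete (u : nat -> R -> R) : (forall n, isL1 (u n)) ->
  (forall eps : R, 0 < eps -> exists M, forall m n, (M <= m)%N -> (M <= n)%N ->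
     L1norm (u m \- u n) < eps) ->
  exists g : R -> R, isL1 g /\ (fun n => L1norm (g \- u n)) @ \oo --> 0.
Proof.
move=> ui cau.
have mI := @measurable_I01 R.
have mu_ n : measurable_fun I01 (u n) by case: (ui n).
have /choice[M HM] : forall j, exists M, forall m n, (M <= m)%N -> (M <= n)%N ->
    L1norm (u m \- u n) < 2^-1 ^+ j.
  by move=> j; apply: cau; rewrite exprn_gt0.
(* Summing the thresholds makes the indices nondecreasing and keeps [M j <= k j]. *)
pose k j := (\sum_(i < j.+1) M i)%N.
have kS j : (k j <= k j.+1)%N by rewrite /k [leqRHS]big_ord_recr leq_addr.
have kM j : (M j <= k j)%N by rewrite /k big_ord_recr leq_addl.
have k_homo : {homo k : i j / (i <= j)%N} by apply: homo_leq => // a b c; exact: leq_trans.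
pose d j t : R := `|u (k j.+1) t - u (k j) t|.
have di j : isL1 (d j) by apply: isL1_abs; apply: isL1B.
have d0 j t : 0 <= d j t by exact: normr_ge0.
have dle j : L1norm (d j) <= 2^-1 ^+ j.
  rewrite /d (@L1norm_abs _ (u (k j.+1) \- u (k j))); apply/ltW/HM; last exact: kM.
  exact: leq_trans (kM j) (kS j).
pose H t : \bar R := (\sum_(j <oo) (d j t)%:E)%E.
have md j : measurable_fun I01 (EFin \o d j) by apply/measurable_EFinP; case: (di j).
have mH : measurable_fun I01 H.
  apply: (@emeasurable_fun_cvg _ _ _ _ (fun n t => \sum_(0 <= j < n) (d j t)%:E)%E).
    by move=> n; apply: emeasurable_sum => j; exact: md.
  move=> t It.
  have : cvgn (fun n => \sum_(0 <= j < n) (d j t)%:E)%E.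
    by apply: is_cvg_nneseries => j _ _; rewrite lee_fin d0.
  exact.
have H0 t : (0 <= H t)%E by apply: nneseries_ge0 => j _ _; rewrite lee_fin d0.
have intH : (\int[lam]_(t in I01) `|H t| < +oo)%E.
  under eq_integral do rewrite gee0_abs//.
  rewrite /H integral_nneseries//; last by move=> j t _; rewrite lee_fin d0.
  apply: (@le_lt_trans _ _ 2%:E); last exact: ltry.
  apply: lime_le.
    by apply: is_cvg_nneseries => j _ _; apply: integral_ge0 => t _; rewrite lee_fin d0.
  apply: nearW => n; apply: (@le_trans _ _ (\sum_(0 <= j < n) (2^-1 ^+ j)%:E)%E).
    apply: lee_sum => j _; apply: le_trans (_ : (L1norm (d j))%:E <= _)%E.
      rewrite EFin_L1norm//; under [leRHS]eq_integral do rewrite /d normr_id.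
      by [].
    by rewrite lee_fin.
  by rewrite sumEFin lee_fin big_mkord sum_half_le.
have Hfin : {ae lam, forall t, I01 t -> (H t \is a fin_num)}.
  apply: (@integrable_ae _ _ _ lam _ mI H); exact/integrableP.
pose A := I01 `&` (H @^-1` [set x | x \is a fin_num]).
have mA : measurable (A : set (measurableTypeR R)).
  exact: emeasurable_fin_num mI mH.
(* Cutting to [A] makes the subsequence converge at every point of [0,1], so its limit is
   measurable. *)
pose v j t : R := u (k j) t * \1_A t.
have vcv t : I01 t -> cvgn (v ^~ t).
  move=> It; case: (boolP (t \in A)) => tA; last first.
    rewrite (_ : v ^~ t = fun=> 0); first exact: is_cvg_cst.
    by apply/funext => j; rewrite /v indicE (negbTE tA) mulr0.
  have [_ /= Ht] := set_mem tA.
  have -> : v ^~ t = (fun n => u (k 0%N) t + series (fun j => u (k j.+1) t - u (k j) t) n).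
    apply/funext => n; rewrite /v indicE tA mulr1 /series/=.
    elim: n => [|n IH]; first by rewrite big_geq// addr0.
    by rewrite big_nat_recr//= addrA -IH; ring.
  apply: is_cvgD; first exact: is_cvg_cst.
  apply: normed_cvg.
  apply: nondecreasing_is_cvgn.
    by apply: nondecreasing_series => i _ _; exact: normr_ge0.
  exists (fine (H t)) => _ [n _ <-].
  rewrite -lee_fin fineK// /series/= -sumEFin.
  apply: (@nneseries_lim_ge _ (fun j => (d j t)%:E)%E xpredT 0%N n) => j _.
  by rewrite lee_fin.
pose g t : R := limn (v ^~ t).
have gcv t : I01 t -> v ^~ t @ \oo --> g t by exact: vcv.
have mv j : measurable_fun I01 (v j).
  apply: measurable_funM; first exact: mu_.
  exact: measurable_indic.
have mg : measurable_fun I01 g by apply: measurable_fun_cvg gcv.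
have gle (eps : R) : 0 < eps -> exists N, forall n, (N <= n)%N ->
    (\int[lam]_(t in I01) (`|g t - u n t|)%:E <= eps%:E)%E.
  move=> eps0; have [N HN] := cau _ eps0.
  have [j0 j0N] : exists j0, (1 <= 2 ^+ j0 * eps).
    have [j Hj] : exists j : nat, eps^-1 <= 2 ^+ j.
      exists (Num.truncn eps^-1).+1; apply/ltW.
      apply: lt_le_trans (truncnS_gt _) _.
      rewrite -natrX ler_nat; exact/ltnW/ltn_expl.
    by exists j; rewrite -ler_pdivrMr// mul1r.
  exists (maxn N (M j0)) => n; rewrite geq_max => /andP[Nn Mn].
  apply: (@ge0_integral_cvg_le _ _ _ lam I01
    (fun i t => (`|u (k (j0 + i)%N) t - u n t|)%:E)) => //.
  - move=> i; apply/measurable_EFinP; apply: measurableT_comp => //.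
    by apply: measurable_funB; exact: mu_.
  - apply/measurable_EFinP; apply: measurableT_comp => //.
    by apply: measurable_funB => //; exact: mu_.
  - apply: ae_lebesgueS Hfin => t + It => /(_ It) Ht.
    have tA : t \in A by apply/mem_set.
    apply: cvg_EFin; first exact: nearW.
    apply: (@cvg_norm _ _ _ _ _ (fun i => u (k (j0 + i)%N) t - u n t)).
    apply: cvgB; last exact: cvg_cst.
    have := gcv t It; rewrite -(cvg_shiftn j0); apply: cvg_trans.
    apply: near_eq_cvg; apply: nearW => i /=.
    by rewrite /v indicE tA mulr1 addnC.
  - move=> i; rewrite -EFin_L1norm; last exact: isL1B.
    rewrite lee_fin; apply/ltW; apply: lt_le_trans (HM j0 _ _ _ Mn) _.
      by apply: leq_trans (kM j0) _; apply: k_homo; exact: leq_addr.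
    by rewrite exprVn -div1r ler_pdivrMr ?exprn_gt0// mulrC.
have gi : isL1 g.
  have [N /(_ N (leqnn _)) HN] := gle 1 ltr01.
  have : isL1 (g \- u N).
    apply/isL1P/integrableP; split.
      by apply/measurable_EFinP; apply: measurable_funB => //; exact: mu_.
    by apply: le_lt_trans HN _; exact: ltry.
  move=> gui; apply: eq_isL1 (isL1D gui (ui N)) => t /=; ring.
exists g; split=> //; apply/cvgrPdist_le => eps eps0.
have [N HN] := gle _ eps0; exists N => //= n /= Nn.
rewrite sub0r normrN ger0_norm ?L1norm_ge0// -lee_fin EFin_L1norm; last exact: isL1B.
exact: HN.
Qed.

End L1_complete.

Section L1_limits.
Context {R : realType}.
Implicit Types (u : nat -> R -> R) (f g h : R -> R).

(** [series_to N c e g] unfolds to [L1cvg (psum N c e) g]. *)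
Definition L1cvg u g : Prop :=
  isL1 g /\ (fun n => L1norm (g \- u n)) @ \oo --> 0.

Lemma L1cvg_norm u g : (forall n, isL1 (u n)) -> L1cvg u g ->
  (fun n => L1norm (u n)) @ \oo --> L1norm g.
Proof.
move=> ui [gi ug]; apply/cvgrPdist_le => eps eps0.
move/cvgrPdist_le : ug => /(_ _ eps0); apply: filterS => n.
rewrite sub0r normrN ger0_norm ?L1norm_ge0//; apply: le_trans.
rewrite ler_norml; apply/andP; split.
  rewrite lerNl opprB lerBlDl L1norm_sub.
  exact: L1norm_sub_le.
by rewrite lerBlDl; exact: L1norm_sub_le.
Qed.

Lemma L1cvg_uniq u g h : (forall n, isL1 (u n)) -> L1cvg u g -> L1cvg u h ->
  L1norm (g \- h) = 0.
Proof.
move=> ui [gi ug] [hi uh]; apply/eqP; rewrite eq_le L1norm_ge0 andbT.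
have : (fun n => L1norm (g \- u n) + L1norm (h \- u n)) @ \oo --> 0 + 0.
  exact: cvgD.
rewrite addr0 => /cvgr_to_ge; apply; apply: nearW => n.
by rewrite (L1norm_sub h) L1norm_triB.
Qed.

Lemma L1cvg_lin a u g b v h : (forall n, isL1 (u n)) -> (forall n, isL1 (v n)) ->
  L1cvg u g -> L1cvg v h ->
  L1cvg (fun n t => a * u n t + b * v n t) (fun t => a * g t + b * h t).
Proof.
move=> ui vi [gi ug] [hi vh]; split; first exact: isL1_lin.
have cv : (fun n => `|a| * L1norm (g \- u n) + `|b| * L1norm (h \- v n)) @ \oo --> 0.
  rewrite -[X in _ --> X](_ : `|a| * 0 + `|b| * 0 = 0); last by rewrite !mulr0 addr0.
  by apply: cvgD; apply: cvgM => //; exact: cvg_cst.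
apply: (squeeze_cvgr _ (cvg_cst 0) cv); apply: nearW => n.
rewrite L1norm_ge0/= -!L1normZ; [|exact: isL1B..].
apply: le_trans (L1normD _ _); [|by apply: isL1Z; exact: isL1B..].
rewrite le_eqVlt; apply/orP; left; apply/eqP; apply: eq_L1norm => t _ /=; ring.
Qed.

Lemma L1cvg_ext u v g : (forall n, isL1 (u n)) -> (forall n, isL1 (v n)) ->
  (forall n, L1norm (v n \- u n) = 0) -> L1cvg u g -> L1cvg v g.
Proof.
move=> ui vi uv [gi ug]; split=> //; apply: (squeeze_cvgr _ (cvg_cst 0) ug).
apply: nearW => n; rewrite L1norm_ge0/=.
apply: le_trans (L1norm_triB gi (ui n) (vi n)) _.
by rewrite (L1norm_sub (u n)) uv addr0.
Qed.

Lemma L1cvg_cauchy u g : (forall n, isL1 (u n)) -> L1cvg u g ->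
  forall eps : R, 0 < eps -> exists M, forall m n, (M <= m)%N -> (M <= n)%N ->
  L1norm (u m \- u n) < eps.
Proof.
move=> ui [gi ug] eps eps0.
have e3 : 0 < eps / 3 by rewrite divr_gt0.
move/cvgrPdist_le : ug => /(_ _ e3)[M _ HM]; exists M => m n Mm Mn.
have := HM _ Mm; have := HM _ Mn => /=.
rewrite !sub0r !normrN !ger0_norm ?L1norm_ge0// => h1 h2.
apply: le_lt_trans (L1norm_triB (ui m) gi (ui n)) _.
rewrite (L1norm_sub (u m)); lra.
Qed.

(** [P v n] are the partial sums whose limit gives the norm of [v], and [U v n] are their images.
    Differences of [U] are controlled by differences of [P], so [U v] is Cauchy and its limit serves
    as [T v], with a = 1 and b = C. *)
Lemma embeds_L1_of_partial (V : Type) (S : set V)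
    (lin : R -> V -> R -> V -> V) (nrm : V -> R -> Prop)
    (U P : V -> nat -> R -> R) (C : R) :
  0 < C ->
  (forall v n, S v -> isL1 (U v n)) -> (forall v n, S v -> isL1 (P v n)) ->
  (forall v m n, S v -> (m <= n)%N ->
     L1norm (U v n \- U v m) <= C * L1norm (P v n \- P v m)) ->
  (forall v n, S v -> L1norm (P v n) <= L1norm (U v n) <= C * L1norm (P v n)) ->
  (forall a v b w n, S v -> S w -> isL1 (U (lin a v b w) n) /\
     L1norm (U (lin a v b w) n \- (fun t => a * U v n t + b * U w n t)) = 0) ->
  (forall v, S v -> exists g, L1cvg (P v) g) ->
  (forall v w, S v -> nrm v w -> exists g, L1cvg (P v) g /\ w = L1norm g) ->
  embeds_L1 S lin nrm C.
Proof.
move=> C0 Ui Pi UP PU Ulin Pcvg nrmP.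
(* The limit is determined only up to null sets; linearity of this choice comes from uniqueness of
   limits and holds almost everywhere. *)
pose T v := xget (fun _ : R => 0 : R) [set g | L1cvg (U v) g].
have TP v : (exists g, L1cvg (U v) g) -> L1cvg (U v) (T v).
  by move=> [g Ug]; rewrite /T; case: xgetP => [y _ //|/(_ g)].
have Ucvg v : S v -> exists g, L1cvg (U v) g.
  move=> Sv; have [p Pp] := Pcvg v Sv.
  have [|eps eps0|g [gi gU]] := @L1_complete _ (U v); last by exists g.
    by move=> n; exact: Ui.
  have [M HM] := L1cvg_cauchy (fun n => Pi v n Sv) Pp (divr_gt0 eps0 C0).
  have UM m n : (m <= n)%N -> (M <= m)%N -> L1norm (U v n \- U v m) < eps.
    move=> mn Mm; apply: le_lt_trans (UP v m n Sv mn) _.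
    by rewrite mulrC -ltr_pdivlMr// HM// (leq_trans Mm).
  exists M => m n Mm Mn; have [mn|nm] := leqP m n.
    by rewrite L1norm_sub UM.
  by rewrite UM// ltnW.
exists T, 1, C; rewrite divr1; do 3 (split=> //).
have TL v : S v -> L1cvg (U v) (T v) by move=> Sv; apply/TP/Ucvg.
split; first by move=> v /TL[].
split=> [v w a b Sv Sw|v w Sv vw].
  have Uvw := L1cvg_lin a b (fun n => Ui v n Sv) (fun n => Ui w n Sw) (TL _ Sv) (TL _ Sw).
  have Ul : L1cvg (U (lin a v b w)) (fun t => a * T v t + b * T w t).
    apply: L1cvg_ext Uvw.
    - by move=> n; apply: isL1_lin; exact: Ui.
    - by move=> n; have [] := Ulin a v b w n Sv Sw.
    - by move=> n; have [] := Ulin a v b w n Sv Sw.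
  have TU := TP (lin a v b w) (ex_intro _ _ Ul).
  have T0 : L1norm (T (lin a v b w) \- (fun t => a * T v t + b * T w t)) = 0.
    apply: L1cvg_uniq TU Ul => n.
    by have [] := Ulin a v b w n Sv Sw.
  have := L1norm_eq0_ae (isL1B TU.1 Ul.1) T0.
  by apply: ae_lebesgueS => t + It => /(_ It) /= /subr0_eq.
have [g [gP ->]] := nrmP v w Sv vw.
have cP := L1cvg_norm (fun n => Pi v n Sv) gP.
have cU := L1cvg_norm (fun n => Ui v n Sv) (TL v Sv).
rewrite mul1r; apply/andP; split.
  by apply: ler_cvg_to cP cU _; apply: nearW => n; have /andP[] := PU v n Sv.
have cCP : (fun n => C * L1norm (P v n)) @ \oo --> C * L1norm g.
  by apply: cvgM => //; exact: cvg_cst.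
by apply: ler_cvg_to cU cCP _; apply: nearW => n; have /andP[] := PU v n Sv.
Qed.

End L1_limits.

(** * Unconditional and concave sequences *)

Section sequence_norm.
Context {R : realType}.
Variables (N : option nat) (e : nat -> R -> R).
Hypothesis ei : forall i, inN N i -> isL1 (e i).

Definition snorm (c : nat -> R) m := L1norm (psum N c e m).

Lemma isL1_psum c m : isL1 (psum N c e m).
Proof. by apply: isL1_sum => i Ni; apply: isL1Z; exact: ei. Qed.

Lemma eq_psum c d m : (forall i, (i < m)%N -> inN N i -> c i = d i) ->
  psum N c e m = psum N d e m.
Proof.
move=> cd; apply/funext => t; apply: eq_bigr => i Ni.
by rewrite cd.
Qed.

Lemma eq_snorm c d m : (forall i, (i < m)%N -> inN N i -> c i = d i) ->
  snorm c m = snorm d m.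
Proof. by move=> cd; rewrite /snorm (eq_psum cd). Qed.

Lemma psum_lin a c b d m t : psum N (fun i => a * c i + b * d i) e m t =
  a * psum N c e m t + b * psum N d e m t.
Proof.
rewrite /psum !mulr_sumr -big_split/=; apply: eq_bigr => i _; ring.
Qed.

Lemma psumZ a c m t : psum N (fun i => a * c i) e m t = a * psum N c e m t.
Proof. by rewrite /psum mulr_sumr; apply: eq_bigr => i _; rewrite mulrA. Qed.

Lemma snormZ a c m : snorm (fun i => a * c i) m = `|a| * snorm c m.
Proof.
rewrite /snorm -L1normZ; last exact: isL1_psum.
by apply: eq_L1norm => t _; rewrite psumZ.
Qed.

Lemma snormD c d m : snorm (fun i => c i + d i) m <= snorm c m + snorm d m.
Proof.
apply: le_trans (L1normD (isL1_psum c m) (isL1_psum d m)).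
rewrite le_eqVlt; apply/orP; left; apply/eqP; apply: eq_L1norm => t _.
by rewrite /psum -big_split/=; apply: eq_bigr => i _; rewrite mulrDl.
Qed.

Lemma snorm_ge0 c m : 0 <= snorm c m. Proof. exact: L1norm_ge0. Qed.

(** A tail is again a partial sum, with the first m coefficients set to 0, so bounds valid for all
    coefficient sequences yield Cauchy estimates. *)
Lemma psum_tail c m n : (m <= n)%N ->
  psum N c e n \- psum N c e m = psum N (fun i => if (m <= i)%N then c i else 0) e n.
Proof.
move=> mn; apply/funext => t; rewrite /psum /=.
rewrite -(big_mkord (fun i => inN N i) (fun i => c i * e i t)).
rewrite -(big_mkord (fun i => inN N i) (fun i => (if (m <= i)%N then c i else 0) * e i t)).
rewrite -(big_mkord (fun i => inN N i) (fun i => c i * e i t)).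
rewrite (big_cat_nat (n := m))//= [RHS](big_cat_nat (n := m))//=.
rewrite addrAC subrr add0r [X in _ = X + _]big_nat_cond.
rewrite [X in _ = X + _]big1 ?add0r => [|i /andP[/andP[_ im] _]]; last first.
  by rewrite leqNgt im mul0r.
rewrite big_nat_cond [RHS]big_nat_cond; apply: eq_bigr => i /andP[/andP[-> _] _].
by [].
Qed.

Lemma snorm_lip c d m :
  `|snorm c m - snorm d m| <= \sum_(i < m | inN N i) `|c i - d i| * L1norm (e i).
Proof.
have key c' d' : snorm c' m <= snorm d' m +
    \sum_(i < m | inN N i) `|c' i - d' i| * L1norm (e i).
  apply: le_trans (L1norm_sub_le (isL1_psum c' m) (isL1_psum d' m)) _.
  rewrite lerD2l.
  have -> : psum N c' e m \- psum N d' e m =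
      (fun t => \sum_(i < m | inN N i) (c' i - d' i) * e i t).
    by apply/funext => t /=; rewrite /psum -sumrB; apply: eq_bigr => i _; rewrite mulrBl.
  apply: le_trans (L1norm_sum _ _) _ => [i Ni|]; first by apply: isL1Z; exact: ei.
  by apply: ler_sum => i Ni; rewrite L1normZ//; exact: ei.
rewrite ler_norml; apply/andP; split; last by rewrite lerBlDl key.
rewrite lerNl opprB lerBlDl; apply: le_trans (key d c) _; rewrite lerD2l.
by apply: ler_sum => i _; rewrite distrC.
Qed.

Hypothesis Hu : one_unconditional N e.

Lemma snorm_absE c m : snorm (fun i => `|c i|) m = snorm c m.
Proof. by apply/eqP; rewrite eq_le !Hu// => i _; rewrite normr_id. Qed.

(* Shrinking one coefficient is a convex combination of keeping it and
   flipping its sign. *)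
Lemma snorm_le c d m : (forall i, (i < m)%N -> inN N i -> `|c i| <= `|d i|) ->
  snorm c m <= snorm d m.
Proof.
move=> cd; pose mix k i := if (i < k)%N && inN N i then c i else d i.
rewrite (_ : snorm c m = snorm (mix m) m); last first.
  by apply: eq_snorm => i im Ni; rewrite /mix im Ni.
have: forall k, (k <= m)%N -> snorm (mix k) m <= snorm d m; last exact.
elim=> [|k IH] km; first by rewrite (@eq_snorm (mix 0%N) d).
apply: le_trans (IH (ltnW km)).
have [Nk|Nk] := boolP (inN N k); last first.
  rewrite (@eq_snorm (mix k.+1) (mix k))// => i _ Ni; rewrite /mix Ni !andbT ltnS.
  by rewrite leq_eqVlt; case: eqP => // ik; rewrite ik (negbTE Nk) in Ni.
have [th [th1 cth]] : exists th, `|th| <= 1 /\ c k = th * d k.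
  have [dk0|dk0] := eqVneq (d k) 0.
    exists 0; rewrite normr0 ler01; split=> //.
    have := cd k km Nk; rewrite dk0 normr0 normr_le0 => /eqP ->; ring.
  exists (c k / d k); rewrite divfK//; split=> //.
  by rewrite normrM normfV ler_pdivrMr ?normr_gt0// mul1r cd.
pose fl i := if i == k then - d i else mix k i.
rewrite (@eq_snorm (mix k.+1)
  (fun i => (1 + th) / 2 * mix k i + (1 - th) / 2 * fl i)); last first.
  move=> i _ Ni; rewrite /fl /mix Ni !andbT ltnS leq_eqVlt.
  case: eqP => [->|_] /=; last by case: ifP => _; field.
  by rewrite ltnn cth; field.
apply: le_trans (snormD _ _ _) _; rewrite !snormZ.
have -> : snorm fl m = snorm (mix k) m.
  apply/eqP; rewrite eq_le !Hu// => i _; rewrite /fl /mix; case: eqP => // ->.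
    by rewrite ltnn normrN.
  by rewrite ltnn normrN.
have /andP[t1 t2] : - 1 <= th <= 1 by rewrite -ler_norml.
rewrite -mulrDl ger0_norm ?divr_ge0//; last by rewrite -lerBlDl sub0r.
rewrite ger0_norm ?divr_ge0 ?subr_ge0//.
by rewrite (_ : (1 + th) / 2 + (1 - th) / 2 = 1) ?mul1r//; field.
Qed.

End sequence_norm.

(** * Power means and quantisation *)

Section powers.
Context {R : realType}.
Implicit Types (x y r : R).

Lemma ler_powR2r r x y : 0 <= r -> 0 <= x -> x <= y -> x `^ r <= y `^ r.
Proof.
move=> r0 x0 xy; apply: ge0_ler_powR => //; rewrite nnegrE//.
exact: le_trans xy.
Qed.

Lemma powRVK r x : r != 0 -> 0 <= x -> (x `^ r^-1) `^ r = x.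
Proof. by move=> r0 x0; rewrite -powRrM mulVf// powRr1. Qed.

Lemma powRKV r x : r != 0 -> 0 <= x -> (x `^ r) `^ r^-1 = x.
Proof. by move=> r0 x0; rewrite -powRrM mulfV// powRr1. Qed.

(** Young's inequality for the product x * 1; the form 1 - 1/r of the inverse conjugate exponent
    stays meaningful at r = 1. *)
Lemma le_young1 r x : 1 <= r -> 0 <= x -> x <= x `^ r / r + (1 - r^-1).
Proof.
rewrite le_eqVlt => /predU1P[<-|r1] x0.
  by rewrite powRr1// invr1 subrr addr0 mulr1.
have r0 : 0 < r by lra.
have q0 : 0 < 1 - r^-1 by rewrite subr_gt0 invf_lt1.
have := @conjugate_powR _ x 1 r (1 - r^-1)^-1 x0 ler01 r0.
rewrite invr_gt0 mulr1 powR1 div1r invrK addrCA subrr addr0.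
by move=> /(_ q0 erefl).
Qed.

(** After division by [A], the r-th root of the right-hand sum, Young's inequality averages to 1/r +
    (1 - 1/r) = 1. *)
Lemma power_mean (I : finType) (p a : I -> R) r : 1 <= r ->
  (forall k, 0 <= p k) -> (forall k, 0 <= a k) -> \sum_k p k = 1 ->
  \sum_k p k * a k <= (\sum_k p k * a k `^ r) `^ r^-1.
Proof.
move=> r1 p0 a0 p1; have r0 : 0 < r by lra.
set S := \sum_k p k * a k `^ r.
have S0 : 0 <= S by apply: sumr_ge0 => k _; rewrite mulr_ge0// powR_ge0.
have [Sz|Sn0] := eqVneq S 0.
  rewrite Sz powR0 ?invr_eq0 ?gt_eqF// big1// => k _.
  have /eqP := Sz; rewrite psumr_eq0 => [/allP/(_ k)|i _].
    rewrite mem_index_enum => /(_ isT) /=; rewrite mulf_eq0 powR_eq0.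
    by case/orP => [/eqP ->|/andP[/eqP -> _]]; rewrite ?mul0r ?mulr0.
  by rewrite mulr_ge0// powR_ge0.
have Sp : 0 < S by rewrite lt_neqAle eq_sym Sn0.
set A := S `^ r^-1; have Ap : 0 < A by rewrite powR_gt0.
suff : \sum_k p k * (a k / A) <= 1.
  by under eq_bigr do rewrite mulrA; rewrite -mulr_suml ler_pdivrMr// mul1r.
apply: (@le_trans _ _ (\sum_k p k * ((a k / A) `^ r / r + (1 - r^-1)))).
  apply: ler_sum => k _; apply: ler_wpM2l => //.
  by apply: le_young1 => //; rewrite divr_ge0// ltW.
under eq_bigr do rewrite mulrDr.
rewrite big_split/= -mulr_suml p1 mul1r.
have ArS : A `^ r = S by rewrite /A powRVK ?gt_eqF.
have E k : p k * ((a k / A) `^ r / r) = p k * a k `^ r * (S^-1 / r).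
  rewrite -ArS -powRN -[in X in _ = _ * (X / _)]mulN1r powRrM powR_inv1 ?(ltW Ap)//.
  by rewrite powRM ?invr_ge0 ?(ltW Ap)// !mulrA.
under eq_bigr do rewrite E.
by rewrite -mulr_suml -/S mulrA mulfV// mul1r addrC subrK.
Qed.

End powers.

Section quantisation.
Context {R : realType}.

(** The approximation min(floor(n y), n^2) / n of y >= 0, written as a sum of threshold indicators:
    it depends on y only through finitely many comparisons, each of them measurable in y. *)
Definition quant (n : nat) (y : R) : R :=
  (\sum_(j < n * n) ((j.+1%:R <= n%:R * y)%R : nat))%N%:R / n%:R.

Lemma sum_ltn_minn (k M : nat) : (\sum_(j < M) (j < k) = minn k M)%N.
Proof.
elim: M => [|M IH]; first by rewrite big_ord0 minn0.
by rewrite big_ord_recr/= IH; case: ltnP; lia.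
Qed.

Lemma quantE n y : quant n y = (minn (Num.truncn (n%:R * y)) (n * n))%:R / n%:R.
Proof.
rewrite /quant -sum_ltn_minn; congr (_%:R / _); apply: eq_bigr => j _.
by rewrite truncn_gt_nat.
Qed.

Lemma quant_ge0 n y : 0 <= quant n y.
Proof. by rewrite divr_ge0. Qed.

Lemma quant_le n y : 0 <= y -> quant n y <= y.
Proof.
move=> y0; rewrite quantE; case: n => [|n]; first by rewrite invr0 mulr0.
rewrite ler_pdivrMr// [leRHS]mulrC; apply: (@le_trans _ _ (Num.truncn (n.+1%:R * y))%:R).
  by rewrite ler_nat geq_minl.
by rewrite truncn_le mulr_ge0.
Qed.

Lemma quant_cvg y : 0 <= y -> (fun n => quant n y) @ \oo --> y.
Proof.
move=> y0; apply/cvgrPdist_le => eps eps0.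
exists (maxn (Num.truncn y).+1 (Num.truncn eps^-1).+1) => // n /=.
rewrite geq_max => /andP[n1 n2].
have n0 : (0 < n)%N by case: n n1 n2.
have n0R : (0 : R) < n%:R by rewrite ltr0n.
have yn : y < n%:R.
  by apply: lt_le_trans (truncnS_gt _) _; rewrite ler_nat.
have en : eps^-1 < n%:R.
  by apply: lt_le_trans (truncnS_gt _) _; rewrite ler_nat.
rewrite ger0_norm ?subr_ge0 ?quant_le// quantE (minn_idPl _); last first.
  rewrite -ltnS truncn_lt_nat ?mulr_ge0//; apply: (@lt_trans _ _ (n * n)%:R).
    by rewrite natrM ltr_pM2l.
  by rewrite ltr_nat.
have k1 := truncnS_gt (n%:R * y).
rewrite lerBlDr -(ler_pM2l n0R) mulrDr mulrCA divff ?gt_eqF// mulr1.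
have en1 : 1 <= n%:R * eps.
  by rewrite -ler_pdivrMr// mul1r ltW.
rewrite -natr1 in k1; lra.
Qed.

End quantisation.

(** * Concavity from finite sums to integrals *)

Section integral_concavity.
Context {R : realType} d (T : measurableType d) (nu : {measure set T -> \bar R}).
Variable w : T -> R.
Hypothesis mw : measurable_fun setT w.
Hypothesis w0 : forall t, 0 <= w t.
Hypothesis w1 : (\int[nu]_t (w t)%:E = 1)%E.

Section finite_valued.
Variables (I : finType) (kap : T -> I).
Hypothesis mkap : forall k, measurable (kap @^-1` [set k]).

Let p k := fine (\int[nu]_t (\1_(kap @^-1` [set k]) t * w t)%:E).

Let mpw k : measurable_fun setT (fun t => \1_(kap @^-1` [set k]) t * w t).
Proof. by apply: measurable_funM => //; exact: measurable_indic. Qed.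

Let pE k : (p k)%:E = (\int[nu]_t (\1_(kap @^-1` [set k]) t * w t)%:E)%E.
Proof.
rewrite /p fineK// ge0_fin_numE; last first.
  by apply: integral_ge0 => t _; rewrite lee_fin mulr_ge0// indicE ler0n.
apply: (@le_lt_trans _ _ (\int[nu]_t (w t)%:E)%E); last by rewrite w1 ltry.
apply: ge0_le_integral => //.
- by move=> t _; rewrite lee_fin mulr_ge0.
- exact/measurable_EFinP.
- exact/measurable_EFinP.
- by move=> t _; rewrite lee_fin ler_piMl// indicE lern1 leq_b1.
Qed.

Let p0 k : 0 <= p k.
Proof.
by rewrite /p fine_ge0// integral_ge0// => t _; rewrite lee_fin mulr_ge0.
Qed.

Lemma finite_valuedE (h : I -> R) t :
  h (kap t) * w t = \sum_k h k * (\1_(kap @^-1` [set k]) t * w t).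
Proof.
rewrite (bigD1 (kap t))//= indicE mem_set// mul1r big1 ?addr0// => k kt.
rewrite indicE memNset ?mul0r ?mulr0//= => /esym/eqP; exact/negP.
Qed.

Lemma measurable_finite_valued (h : I -> R) :
  measurable_fun setT (fun t => h (kap t) * w t).
Proof.
rewrite (_ : (fun t => _) = (fun t => \sum_k h k * (\1_(kap @^-1` [set k]) t * w t))).
  by apply: measurable_sum => k; apply: measurable_funM.
by apply/funext => t; exact: finite_valuedE.
Qed.

Lemma integral_finite_valued (h : I -> R) : (forall k, 0 <= h k) ->
  (\int[nu]_t (h (kap t) * w t)%:E = (\sum_k h k * p k)%:E)%E.
Proof.
move=> h0; under eq_integral do rewrite finite_valuedE -sumEFin.
rewrite ge0_integral_sum//; last 2 first.
- by move=> k; apply/measurable_EFinP; exact: measurable_funM.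
- by move=> k t _; rewrite lee_fin !mulr_ge0.
rewrite -sumEFin; apply: eq_bigr => k _.
under eq_integral do rewrite EFinM.
rewrite ge0_integralZl_EFin//; last 2 first.
- by move=> t _; rewrite lee_fin mulr_ge0.
- exact/measurable_EFinP.
by rewrite EFinM pE.
Qed.

Variables (N : option nat) (e : nat -> R -> R) (r K : R).
Hypothesis ei : forall i, inN N i -> isL1 (e i).
Hypothesis r1 : 1 <= r.
Hypothesis rc : r_concave N e r K.

(** The integral is a finite average with weights p_k of total mass 1. It is at most the r-th power
    mean, and concavity applied to the vectors p_k^(1/r) be_k brings the r-th powers inside the
    norm. *)
Lemma finite_valued_concave (be : I -> nat -> R) m :
  (\int[nu]_t (snorm N e (be (kap t)) m * w t)%:E <=
   (K * snorm N e (fun i =>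
      fine (\int[nu]_t (`|be (kap t) i| `^ r * w t)%:E)%E `^ r^-1) m)%:E)%E.
Proof.
have r0 : 0 < r by exact: lt_le_trans ltr01 r1.
rewrite (integral_finite_valued (h := fun k => snorm N e (be k) m)); last first.
  by move=> k; exact: snorm_ge0.
rewrite lee_fin.
have sp : \sum_k p k = 1.
  apply: EFin_inj; rewrite -w1; have := @integral_finite_valued (fun=> 1) (fun=> ler01).
  under eq_integral do rewrite mul1r.
  by move=> ->; congr (_%:E); apply: eq_bigr => k _; rewrite mul1r.
under eq_bigr do rewrite mulrC.
apply: le_trans (power_mean r1 p0 (fun k => snorm_ge0 N e (be k) m) sp) _.
pose a (k : 'I_#|I|) (j : nat) := p (enum_val k) `^ r^-1 * be (enum_val k) j.
have := rc m a.
have reix (F : I -> R) : \sum_k F k = \sum_(k < #|I|) F (enum_val k).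
  rewrite -(big_enum_val F).
  by apply: eq_bigl => k.
have -> : \sum_(k < #|I|) L1norm (psum N (a k) e m) `^ r =
    \sum_k p k * snorm N e (be k) m `^ r.
  rewrite reix; apply: eq_bigr => k _.
  rewrite -/(snorm N e (a k) m) snormZ// ger0_norm ?powR_ge0//.
  by rewrite powRM ?powR_ge0 ?snorm_ge0// powRVK ?gt_eqF.
congr (_ <= K * snorm N e _ m); apply/funext => j; congr (_ `^ _).
rewrite (integral_finite_valued (h := fun k => `|be k j| `^ r)); last first.
  by move=> k; exact: powR_ge0.
rewrite /= reix; apply: eq_bigr => k _; rewrite normrM ger0_norm ?powR_ge0//.
by rewrite powRM ?powR_ge0// powRVK ?gt_eqF// mulrC.
Qed.

End finite_valued.
Variables (N : option nat) (e : nat -> R -> R) (r K : R).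
Hypothesis ei : forall i, inN N i -> isL1 (e i).
Hypothesis Hu : one_unconditional N e.
Hypothesis r1 : 1 <= r.
Hypothesis rc : r_concave N e r K.
Variables (b : nat -> T -> R) (m : nat).
Hypothesis mb : forall i, (i < m)%N -> inN N i -> measurable_fun setT (b i).

(** Measurability is assumed only for coordinates in range; putting 0 elsewhere makes all
    coordinates measurable and leaves the norm unchanged. *)
Let b' i : T -> R := if (i < m)%N && inN N i then b i else fun=> 0.

Let mb' i : measurable_fun setT (b' i).
Proof.
rewrite /b'; case: ifPn => [/andP[im Ni]|_]; [exact: mb|exact: measurable_cst].
Qed.

(** The outcome of all threshold comparisons at [t], an element of a finite type, from which [dec]
    reads back the quantised moduli. This brings the quantised vector into the finite-valued
    setting. *)
Let cell n t : {ffun 'I_m * 'I_(n * n) -> bool} :=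
  [ffun q : 'I_m * 'I_(n * n) => q.2.+1%:R <= n%:R * `|b' q.1 t|].

Let mcell n k : measurable (cell n @^-1` [set k]).
Proof.
rewrite (_ : _ @^-1` _ = \big[setI/setT]_(q : 'I_m * 'I_(n * n))
    ((fun t => q.2.+1%:R <= n%:R * `|b' q.1 t|) @^-1` [set k q])).
  apply: bigsetI_measurable => q _; rewrite -[X in measurable X]setTI.
  apply: (measurable_fun_ler (f := cst q.2.+1%:R)) => //.
  by apply: measurable_funM => //; apply: measurableT_comp.
rewrite -bigcap_seq; apply/seteqP; split => t /=.
  by move=> <- q _ /=; rewrite ffunE.
move=> H; apply/ffunP => q; rewrite ffunE; apply: H.
by rewrite /= mem_index_enum.
Qed.

Let dec n (k : {ffun 'I_m * 'I_(n * n) -> bool}) (i : nat) : R :=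
  if insub i is Some i' then (\sum_j (k (i', j) : nat))%N%:R / n%:R else 0.

Let dec_cell n t i : (i < m)%N -> dec (cell n t) i = quant n `|b' i t|.
Proof.
move=> im; rewrite /dec insubT /quant; congr (_%:R / _).
by apply: eq_bigr => j _; rewrite ffunE.
Qed.

Let b'E t : snorm N e (b' ^~ t) m = snorm N e (b ^~ t) m.
Proof. by apply: eq_snorm => i im Ni; rewrite /b' im Ni. Qed.

Let dec_cvg t : (fun n => snorm N e (dec (cell n t)) m * w t) @ \oo -->
  snorm N e (b ^~ t) m * w t.
Proof.
apply: cvgM; last exact: cvg_cst.
rewrite -b'E -(snorm_absE Hu); apply/cvgrPdist_le => eps eps0.
have cv : (fun n => \sum_(i < m | inN N i)
    `|(`|b' i t|) - dec (cell n t) i| * L1norm (e i)) @ \oo --> 0.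
  rewrite -[X in _ --> X](_ : \sum_(i < m | inN N i)
      `|(`|b' i t|) - `|b' i t| | * L1norm (e i) = 0); last first.
    by rewrite big1// => i _; rewrite subrr normr0 mul0r.
  apply: (cvg_big (op := +%R)) => [|i _]; first exact: add_continuous.
  apply: cvgM; last exact: cvg_cst.
  apply: cvg_norm; apply: cvgB; first exact: cvg_cst.
  under eq_fun do rewrite dec_cell//.
  exact: quant_cvg.
move/cvgrPdist_le : cv => /(_ _ eps0); apply: filterS => n.
rewrite sub0r normrN ger0_norm; last first.
  by apply: sumr_ge0 => i _; rewrite mulr_ge0// L1norm_ge0.
by apply: le_trans; exact: snorm_lip.
Qed.

Lemma measurable_snorm : measurable_fun setT (fun t => snorm N e (b ^~ t) m * w t).
Proof.
apply: (measurable_fun_cvg (h := fun n t => snorm N e (dec (cell n t)) m * w t)).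
  move=> n; exact: (measurable_finite_valued (@mcell n)
    (fun k => snorm N e (@dec n k) m)).
by move=> t _; exact: dec_cvg.
Qed.

(** The quantised moduli lie below |b i| and converge to it, so the finite-valued inequality applies
    with coefficients at most [D i], and Fatou gives the limit. Enlarging the right-hand side needs
    a nonnegative factor, hence |K|. *)
Lemma integral_concave (D : nat -> R) : (forall i, 0 <= D i) ->
  (forall i, (i < m)%N -> inN N i ->
     (\int[nu]_t (`|b i t| `^ r * w t)%:E <= (D i `^ r)%:E)%E) ->
  (\int[nu]_t (snorm N e (b ^~ t) m * w t)%:E <= (`|K| * snorm N e D m)%:E)%E.
Proof.
move=> D0 bD; have r0 : 0 < r by exact: lt_le_trans ltr01 r1.
apply: (@ge0_integral_cvg_le _ _ _ nu setT
  (fun n t => (snorm N e (dec (cell n t)) m * w t)%:E)) => //.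
- move=> n; apply/measurable_EFinP.
  exact: (measurable_finite_valued (@mcell n) (fun k => snorm N e (@dec n k) m)).
- apply/measurable_EFinP; exact: measurable_snorm.
- by move=> n t _; rewrite lee_fin mulr_ge0// snorm_ge0.
- by move=> t _; rewrite lee_fin mulr_ge0// snorm_ge0.
- apply/nearW => t _; apply: cvg_EFin; first exact: nearW.
  exact: dec_cvg.
move=> n; apply: le_trans (finite_valued_concave (@mcell n) ei r1 rc (@dec n) m) _.
rewrite lee_fin; apply: (@le_trans _ _ (`|K| * snorm N e (fun i =>
      fine (\int[nu]_t (`|dec (cell n t) i| `^ r * w t)%:E)%E `^ r^-1) m)).
  by apply: ler_wpM2r; [exact: snorm_ge0|exact: ler_norm].
apply: ler_wpM2l => //; apply: (snorm_le ei Hu) => i im Ni.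
rewrite !ger0_norm ?powR_ge0// -[leRHS](@powRKV _ r) ?gt_eqF//.
apply: ler_powR2r; rewrite ?invr_ge0 ?(ltW r0)//.
  by rewrite fine_ge0// integral_ge0// => t _; rewrite lee_fin mulr_ge0// powR_ge0.
rewrite -lee_fin; apply: le_trans (bD i im Ni).
have mbi := mb im Ni.
have le1 : (\int[nu]_t (`|dec (cell n t) i| `^ r * w t)%:E <=
    \int[nu]_t (`|b i t| `^ r * w t)%:E)%E.
  apply: ge0_le_integral => //.
  - by move=> t _; rewrite lee_fin mulr_ge0// powR_ge0.
  - apply/measurable_EFinP.
    exact: (measurable_finite_valued (@mcell n) (fun k => `|@dec n k i| `^ r)).
  - apply/measurable_EFinP; apply: measurable_funM => //.
    apply: (measurableT_comp (measurable_powR r)).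
    exact: measurableT_comp.
  - move=> t _; rewrite lee_fin ler_wpM2r// ler_powR2r ?(ltW r0)//.
    rewrite dec_cell// /b' im Ni/= ger0_norm ?quant_ge0//.
    exact: quant_le.
rewrite fineK// ge0_fin_numE; last first.
  by apply: integral_ge0 => t _; rewrite lee_fin mulr_ge0// powR_ge0.
by apply: le_lt_trans le1 _; apply: le_lt_trans (bD i im Ni) _; exact: ltry.
Qed.

End integral_concavity.

(** * Transporting a product measure to the unit interval *)

Section binary_coding.
Context {R : realType}.

(* Digits 0 and 1 in base 4: such expansions are unique, so they can be read
   back from the sum. *)
Fixpoint code_num (dg : nat -> bool) (n : nat) : nat :=
  if n is n'.+1 then (4 * code_num dg n' + dg n')%N else 0%N.

Definition code_approx (dg : nat -> bool) (n : nat) : R :=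
  (code_num dg n)%:R / 4 ^+ n.

Definition code (dg : nat -> bool) : R := limn (code_approx dg).

Lemma code_approxS dg n :
  code_approx dg n.+1 = code_approx dg n + (dg n : nat)%:R / 4 ^+ n.+1.
Proof.
rewrite /code_approx /= natrD natrM exprS.
have : (4 : R) ^+ n != 0 by rewrite expf_neq0.
move: (4 ^+ n) (code_num dg n)%:R (dg n : nat)%:R => a b c a0.
by field.
Qed.

Lemma code_approx_nd dg : nondecreasing_seq (code_approx dg).
Proof.
apply/nondecreasing_seqP => n; rewrite code_approxS lerDl.
by rewrite divr_ge0// exprn_ge0.
Qed.

(** The digits from position n on contribute at most 4^-(n+1) + 4^-(n+2) + ... = (1/3) 4^-n; the
    approximation plus this allowance is nonincreasing. *)
Lemma code_approx_ub dg n m : (n <= m)%N ->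
  code_approx dg m <= code_approx dg n + 3^-1 / 4 ^+ n.
Proof.
move=> nm; suff : code_approx dg m + 3^-1 / 4 ^+ m <= code_approx dg n + 3^-1 / 4 ^+ n.
  by apply: le_trans; rewrite lerDl divr_ge0 ?invr_ge0// exprn_ge0.
elim: m nm => [|m IH]; first by rewrite leqn0 => /eqP ->.
rewrite leq_eqVlt => /predU1P[-> //|]; rewrite ltnS => /IH; apply: le_trans.
rewrite code_approxS -addrA lerD2l exprS.
have : (0 : R) < 4 ^+ m by rewrite exprn_gt0.
move: (4 ^+ m) => a a0.
rewrite -(ler_pM2r a0) mulrDl !mulfVK ?gt_eqF// invfM !mulrA !mulfVK ?gt_eqF//.
by case: (dg m) => /=; lra.
Qed.

Lemma code_approx_cvg dg : code_approx dg @ \oo --> code dg.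
Proof.
apply: nondecreasing_is_cvgn; first exact: code_approx_nd.
exists (code_approx dg 0 + 3^-1 / 4 ^+ 0) => _ [n _ <-].
exact: code_approx_ub.
Qed.

Definition digit (n : nat) (z : R) : bool := odd (Num.truncn (4 ^+ n.+1 * z)).

(** Scaled by 4^(n+1), the remainder is at most 1/3 < 1. Truncation therefore returns
    [code_num dg n.+1], whose parity is its last digit. *)
Lemma codeK dg n : digit n (code dg) = dg n.
Proof.
have a0 : (0 : R) < 4 ^+ n.+1 by rewrite exprn_gt0.
have h1 : code_approx dg n.+1 <= code dg.
  by apply: nondecreasing_cvgn_le; [exact: code_approx_nd|exact: code_approx_cvg].
have h2 : code dg <= code_approx dg n.+1 + 3^-1 / 4 ^+ n.+1.
  apply: limr_le; first exact: code_approx_cvg.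
  by exists n.+1 => // m /=; exact: code_approx_ub.
rewrite /digit (@truncn_def _ _ (code_num dg n.+1)).
  by rewrite /= oddD oddM /=; case: (dg n).
apply/andP; split.
  by move: h1; rewrite /code_approx ler_pdivrMr// mulrC.
apply: (@le_lt_trans _ _ ((code_num dg n.+1)%:R + 3^-1)).
  by move: h2; rewrite /code_approx -mulrDl ler_pdivlMr// mulrC.
by rewrite -[ltRHS]natr1 ltrD2l invf_lt1// ltr1n.
Qed.

Lemma measurable_digit n : measurable (digit n @^-1` [set true]).
Proof.
pose S j := [set z : R | (Num.truncn (4 ^+ n.+1 * z) <= j)%N].
have mS j : measurable (S j).
  rewrite (_ : S j = (fun z : R => 4 ^+ n.+1 * z < j.+1%:R) @^-1` [set true]).
    rewrite -[X in measurable X]setTI.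
    by apply: (measurable_fun_ltr (g := cst j.+1%:R)) => //; exact: measurable_funM.
  by apply/seteqP; split=> z; rewrite /S /= truncn_le_nat.
rewrite (_ : _ @^-1` _ = \bigcup_(j in [set j | odd j]) (S j `\` S j.-1)).
  by apply: bigcup_measurable => j _; exact: measurableD.
apply/seteqP; split=> z /=.
  move=> dz; exists (Num.truncn (4 ^+ n.+1 * z)); first exact: dz.
  split; rewrite /S/= ?leqnn//; move: dz; rewrite /digit.
  by case: (Num.truncn _) => //= k _; rewrite ltnn.
move=> [[|j]//= oj]; rewrite /S/= => -[z1 /negP]; rewrite -ltnNge => z2.
by rewrite /digit (_ : Num.truncn _ = j.+1)//; apply/eqP; rewrite eqn_leq z1.
Qed.

Definition rat_seq (i : nat) : R := if unpickle i is Some q then ratr q else 0.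

(** The Dedekind cuts of the two coordinates are interleaved, the first on even positions and the
    second on odd ones. *)
Definition pair_digit (z : R * R) (k : nat) : bool :=
  rat_seq k./2 < (if odd k then z.2 else z.1).

Definition pair_code (z : R * R) : R := code (pair_digit z).

(* A real is the supremum of the rationals below it, which are the digits of
   its code. *)
Definition decode (b : bool) (z : R) : R :=
  fine (esups (fun i => if digit (b + i.*2) z then (rat_seq i)%:E else -oo%E) 0).

Lemma esups_rat_seq (x : R) :
  esups (fun i => if rat_seq i < x then (rat_seq i)%:E else -oo%E) 0 = x%:E.
Proof.
apply/eqP; rewrite eq_le; apply/andP; split.
  apply: ge_ereal_sup => _ [i _ <-].
  by case: ifPn => [/ltW|_]; rewrite ?leNye ?lee_fin.
apply/lee_addgt0Pr => eps eps0.
have [|q] := @rat_in_itvoo R (x - eps) x; first by rewrite gtrBl.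
rewrite in_itv/= => /andP[q1 q2].
rewrite -leeBlDr//; apply: (@le_trans _ _ (rat_seq (pickle q))%:E).
  by rewrite /rat_seq pickleK -EFinB lee_fin ltW.
apply: ereal_sup_ubound; exists (pickle q) => //=.
by rewrite {1}/rat_seq pickleK q2.
Qed.

Lemma pair_codeK (b : bool) z : decode b (pair_code z) = if b then z.2 else z.1.
Proof.
rewrite /decode -[RHS]/(fine (if b then z.2 else z.1)%:E) -esups_rat_seq.
congr (fine (esups _ _)); apply/funext => i; rewrite codeK /pair_digit.
rewrite oddD odd_double addbF oddb.
suff -> : (b + i.*2)./2 = i by [].
by case: b; rewrite /= ?uphalf_double// half_double.
Qed.

Lemma measurable_decode b : measurable_fun setT (decode b).
Proof.
apply: (measurableT_comp (fine_measurable measurableT)).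
apply: measurable_fun_esups => i; apply: measurable_fun_ifT => //.
apply: (measurable_fun_bool true); rewrite setTI; exact: measurable_digit.
Qed.

Lemma measurable_pair_code : measurable_fun setT pair_code.
Proof.
apply: (measurable_fun_cvg (h := fun n z => code_approx (pair_digit z) n)); last first.
  by move=> z _; exact: code_approx_cvg.
elim=> [|n IH].
  by rewrite (_ : (fun _ => _) = cst 0)//; apply/funext => z; rewrite /code_approx mul0r.
under eq_fun do rewrite code_approxS.
apply: measurable_funD => //; apply: measurable_funM => //.
rewrite (_ : (fun _ => _) =
    (fun z => \1_(`]rat_seq n./2, +oo[%classic : set R) (if odd n then z.2 else z.1))).
  have mi : measurable_fun setT (\1_(`]rat_seq n./2, +oo[%classic : set R) : R -> R).
    by apply: measurable_indic; exact: measurable_itv.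
  apply: (measurableT_comp mi).
  by case: (odd n); [exact: measurable_snd|exact: measurable_fst].
apply/funext => z /=; rewrite indicE /pair_digit; congr (_%:R); congr nat_of_bool.
by rewrite mem_setE in_itv/= andbT.
Qed.

End binary_coding.

Definition mfun_of d1 d2 (T1 : measurableType d1) (T2 : measurableType d2)
  (f : T1 -> T2) (mf : measurable_fun setT f) : {mfun T1 >-> T2} :=
  mfun_Sub (mem_set mf).

(** * Quantile functions and the transport map *)

Section transport.
Context {R : realType}.
Local Notation I01 := (`[0%R, 1%R]%classic : set R).
Local Notation lam := (@lebesgue_measure R).
Local Notation U := (uniform_prob (@ltr01 R)).

Lemma integral_U (f : R -> \bar R) : measurable_fun setT f ->
  (forall x, (0 <= f x)%E) ->
  (\int[U]_x f x = \int[lam]_(x in I01) f x)%E.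
Proof. by move=> mf f0; rewrite integral_uniform// subr0 invr1 mul1e. Qed.

Lemma uniform_probE (A : set R) : measurable A -> U A = lam (A `&` I01).
Proof.
move=> mA; have -> : U A = (\int[U]_x (\1_A x)%:E)%E by rewrite integral_indic// setIT.
rewrite integral_U ?integral_indic//; apply/measurable_EFinP.
exact: measurable_indic.
Qed.

Lemma lebesgue_measure0r (a : R) b0 b1 : 0 <= a ->
  lam [set` Interval (BSide b0 0) (BSide b1 a)] = a%:E.
Proof.
move=> a0; rewrite lebesgue_measure_itv/= lte_fin.
case: ifPn => [_|na]; first by rewrite sube0.
by congr (_%:E); apply/eqP; rewrite eq_le a0 leNgt na.
Qed.

(** The endpoints 0 and 1 are null, so it suffices to locate [A] inside (0,1), the only place where
    the quantile function is under control. *)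
Lemma uniform_prob_between (A : set R) (a : R) : measurable A -> 0 <= a <= 1 ->
  `]0, a[ `<=` A -> A `&` `]0, 1[ `<=` `]0, a] -> U A = a%:E.
Proof.
move=> mA /andP[a0 a1] lA Au; rewrite uniform_probE//.
have mI : measurable (I01 : set (measurableTypeR R)) by exact: measurable_I01.
have mAI : measurable (A `&` I01 : set (measurableTypeR R)) by exact: measurableI.
pose B : set (measurableTypeR R) := `]0, a]%classic `|` ([set 0] `|` [set 1]).
have m01 : measurable ([set 0] `|` [set 1] : set (measurableTypeR R)).
  by apply: measurableU.
have mB : measurable B by apply: measurableU => //; exact: measurable_itv.
have mo : measurable (`]0, a[%classic : set (measurableTypeR R)).
  exact: measurable_itv.
apply/eqP; rewrite eq_le; apply/andP; split; last first.
  rewrite -(@lebesgue_measure0r a false true)//.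
  apply: le_measure; rewrite ?inE// => x xa; split; first exact: lA.
  move: xa; rewrite /= !in_itv/= => /andP[/ltW -> xa] /=.
  by rewrite (le_trans (ltW xa)).
apply: (@le_trans _ _ (lam B)).
  apply: le_measure; rewrite ?inE// => x [Ax]; rewrite /= in_itv/= => /andP[x0 x1].
  case: (ltgtP 0 x) x0 => // [x0 _|<- _]; last by right; left.
  case: (ltgtP x 1) x1 => // [x1 _|-> _]; last by right; right.
  by left; apply: Au; split=> //=; rewrite in_itv/= x0.
have U2 (C D : set (measurableTypeR R)) : measurable C -> measurable D ->
    (lam (C `|` D) <= lam C + lam D)%E by exact: measureU2.
apply: le_trans (U2 _ _ _ m01) _; first exact: measurable_itv.
apply: (@le_trans _ _ (a%:E + (0 + 0))%E); last by rewrite !adde0.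
apply: leeD; first by rewrite lebesgue_measure0r.
apply: le_trans (U2 _ _ _ _) _ => //.
by apply: leeD; rewrite lebesgue_measure_set1.
Qed.

Section quantile.
Context d (T : measurableType d) (P : probability T R) (X : {RV P >-> R}).
Let F (x : R) : R := fine (cdf X x).

Let F_nd x y : x <= y -> F x <= F y.
Proof. by move=> xy; rewrite fine_le ?fin_num_measure// cdf_nondecreasing. Qed.

Let FE x : (F x)%:E = cdf X x.
Proof. by rewrite /F fineK// fin_num_measure. Qed.

Let F_low u : 0 < u -> exists y, F y < u.
Proof.
move=> u0; have : fine \o cdf X @ -oo --> (0 : R) by exact/fine_cvg/cvg_cdfNy0.
move=> /cvgrPdist_lt/(_ _ u0)[M [_ HM]]; exists (M - 1).
have /HM : M - 1 < M by rewrite gtrBl.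
by rewrite /= sub0r normrN; apply: le_lt_trans; exact: ler_norm.
Qed.

Let F_high u : u < 1 -> exists y, u <= F y.
Proof.
rewrite -subr_gt0 => u1.
have : fine \o cdf X @ +oo --> (1 : R) by exact/fine_cvg/cvg_cdfy1.
move=> /cvgrPdist_lt/(_ _ u1)[M [_ HM]]; exists (M + 1).
have /HM : M < M + 1 by rewrite ltrDl.
move=> /= /(le_lt_trans (ler_norm _)); rewrite /F/=; lra.
Qed.

Let F_rc x u : (forall y, x < y -> u <= F y) -> u <= F x.
Proof.
move=> H; have cv : F @ x^'+ --> F x.
  by apply: fine_cvg; rewrite FE; exact: cdf_right_continuous.
by apply: (cvgr_to_ge cv); near=> y; apply: H; near: y; exact: nbhs_right_gt.
Unshelve. all: by end_near. Qed.

(** The generalised inverse of the distribution function; the value 0 outside (0,1) avoids infima of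
    sets that may be empty or unbounded below. *)
Definition quantile (u : R) : R :=
  if 0 < u < 1 then inf [set x | u <= F x] else 0.

(** The Galois connection between quantile and distribution function: right continuity puts the
    infimum into the set that defines it. *)
Let quantile_le u x : 0 < u < 1 -> (quantile u <= x) = (u <= F x).
Proof.
move=> u01; rewrite /quantile u01; case/andP : u01 => u0 u1.
have [y Fy] := F_low u0; have [z Fz] := F_high u1.
have hi : has_inf [set x | u <= F x].
  split; first by exists z.
  exists y => t /= ut; rewrite leNgt; apply/negP => /ltW/F_nd.
  by rewrite leNgt (lt_le_trans Fy).
apply/idP/idP => [qx|ux]; last by apply: ge_inf => //; case: hi.
apply: F_rc => t xt; have := @inf_adherent _ _ (t - x) _ hi.
rewrite subr_gt0 => /(_ xt)[s us st]; apply: le_trans us _.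
by apply: F_nd; apply/ltW/(lt_le_trans st); lra.
Qed.

Let F01 x : 0 <= F x <= 1.
Proof. by rewrite fine_ge0//= -lee_fin FE cdf_le1. Qed.

Let measurable_quantile_le x : measurable (quantile @^-1` `]-oo, x]).
Proof.
have -> : quantile @^-1` `]-oo, x] =
    (`]0, F x] `&` `]0, 1[) `|` (if 0 <= x then ~` `]0, 1[ else set0).
  apply/seteqP; split=> u /=; rewrite !in_itv/=.
    have [u01|u01] := boolP (0 < u < 1).
      rewrite quantile_le// => ->; left; rewrite andbT.
      by case/andP: u01 => ->.
    rewrite /quantile (negbTE u01) => ->; right => /=.
    by rewrite in_itv/= ; apply/negP.
  move=> [[/andP[u0 ux] u01]|]; first by rewrite quantile_le.
  case: ifP => // x0 /negP; rewrite /= in_itv/= => /negbTE u01.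
  by rewrite /quantile u01.
apply: measurableU; first by apply: measurableI; exact: measurable_itv.
by case: ifP => // _; apply: measurableC; exact: measurable_itv.
Qed.

Lemma measurable_quantile : measurable_fun setT quantile.
Proof.
apply: (measurability (@RGenOInfty.G R)) => [|/= _ [_] [x] -> <-].
  exact: RGenOInfty.measurableE.
rewrite setTI -setCitvl preimage_setC; apply: measurableC.
exact: measurable_quantile_le.
Qed.

(** The two laws are compared on the half-lines ]x, +oo[, which generate the Borel sets and are
    stable under intersection; their complements are handled by the Galois connection. *)
Lemma quantileP (A : set R) : measurable A ->
  U (quantile @^-1` A) = distribution P X A.
Proof.
pose Q := @mfun_of _ _ (measurableTypeR R) R _ measurable_quantile.
move=> mA; change (distribution U Q A = distribution P X A).
apply: (measure_unique (@RGenOInfty.G R) (fun k => `]-k%:R, +oo[%classic)) => //.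
- exact: RGenOInfty.measurableE.
- move=> _ _ [x ->] [y ->]; exists (Num.max x y).
  by apply/seteqP; split=> t /=; rewrite !in_itv/= !andbT gt_max => /andP.
- by move=> k; exists (- k%:R).
- apply/seteqP; split=> // t _; exists (Num.truncn `|t|).+1 => //=.
  rewrite in_itv/= andbT ltrNl; apply: le_lt_trans (truncnS_gt _).
  by rewrite -normrN ler_norm.
- move=> _ [x ->]; rewrite -setCitvl.
  change (distribution U Q (~` `]-oo, x]) = distribution P X (~` `]-oo, x])).
  rewrite (@probability_setC _ _ _ (distribution U Q)); last exact: measurable_itv.
  rewrite (@probability_setC _ _ _ (distribution P X)); last exact: measurable_itv.
  congr (_ - _)%E; rewrite -[RHS]FE.
  apply: uniform_prob_between; [exact: measurable_quantile_le|exact: F01| |].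
    move=> u; rewrite /= !in_itv/= => /andP[u0 uF]; rewrite quantile_le ?ltW//.
    by rewrite u0/=; apply: lt_le_trans uF _; case/andP: (F01 x).
  move=> u [qx u01]; move: qx u01; rewrite /= !in_itv/= => + u01.
  by rewrite quantile_le// => ->; case/andP: u01 => ->.
- by move=> k; apply: le_lt_trans (probability_le1 _ _) _; rewrite ?ltry//; exact: measurable_itv.
Qed.

End quantile.

Let idR (x : measurableTypeR R) : R := x.

Let measurable_idR : measurable_fun setT idR.
Proof. by move=> _ A mA; rewrite setTI. Qed.

(* The uniform distribution, on the canonical measurable structure of [R]
   (the library states it on the isomorphic [measurableTypeR R]). *)
Definition unif : probability R R :=
  distribution U (mfun_of measurable_idR).

Lemma integral_unif (f : R -> \bar R) : measurable_fun setT f ->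
  (forall x, (0 <= f x)%E) ->
  (\int[unif]_x f x = \int[lam]_(x in I01) f x)%E.
Proof. by move=> mf f0; rewrite ge0_integral_distribution// integral_U. Qed.

(** The quantile function of the law of the code carries Lebesgue measure to that law, and decoding
    carries that law to the product measure. *)
Lemma lebesgue_transport (mu : probability R R) : exists phi : R -> R * R,
  measurable_fun setT phi /\
  forall h : R * R -> \bar R, measurable_fun setT h -> (forall z, (0 <= h z)%E) ->
  (\int[lam]_(u in I01) h (phi u) = \int[unif \x mu]_z h z)%E.
Proof.
pose X := mfun_of (@measurable_pair_code R).
pose P : probability (R * R)%type R := (unif \x mu)%E.
pose q := @quantile _ _ P X.
have mq : measurable_fun setT q := @measurable_quantile _ _ P X.
pose chi (z : R) : R * R := (decode false z, decode true z).
have mchi : measurable_fun setT chi.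
  by apply: measurable_fun_pair; exact: measurable_decode.
exists (chi \o q); split; first exact: measurableT_comp.
move=> h mh h0.
pose Q := @mfun_of _ _ (measurableTypeR R) R q mq.
have mhc : measurable_fun setT (h \o chi) by exact: measurableT_comp.
have h0c z : (0 <= (h \o chi) z)%E by exact: h0.
have mhq : measurable_fun setT ((h \o chi) \o q) by exact: measurableT_comp.
transitivity (\int[U]_u ((h \o chi) \o q) u)%E; first by rewrite (integral_U mhq (fun x => h0 _)).
transitivity (\int[distribution U Q]_z (h \o chi) z)%E.
  by rewrite (@ge0_integral_distribution _ _ _ _ _ U Q _ mhc h0c).
transitivity (\int[distribution P X]_z (h \o chi) z)%E.
  apply: eq_measure_integral => A mA _; exact: (@quantileP _ _ P X A mA).
rewrite (@ge0_integral_distribution _ _ _ _ _ P X _ mhc h0c); apply: eq_integral => z _ /=.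
by rewrite /chi !pair_codeK -surjective_pairing.
Qed.

End transport.

(** * Tensor embeddings *)

Lemma measurable_sum_cond d (T : measurableType d) (R : realType) (I : Type)
    (s : seq I) (P : pred I) (F : I -> T -> R) :
  (forall i, P i -> measurable_fun setT (F i)) ->
  measurable_fun setT (fun t => \sum_(i <- s | P i) F i t).
Proof.
move=> mF; under eq_fun do rewrite big_mkcond.
by apply: measurable_sum => i; have [/mF//|_] := boolP (P i).
Qed.

Section tensor.
Context {R : realType}.
Local Notation I01 := (`[0%R, 1%R]%classic : set R).
Local Notation lam := (@lebesgue_measure R).
Variables (N : option nat) (e : nat -> R -> R) (r K : R).
Hypothesis ei : forall i, inN N i -> isL1 (e i).
Hypothesis Hu : one_unconditional N e.
Hypothesis r1 : 1 <= r.
Hypothesis rc : r_concave N e r K.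
Variable mu : probability R R.

Definition munorm (f : R -> R) : R := fine (\int[mu]_t (`|f t|)%:E).

(* [f] lies in the span of functions on which the L_r-norm relative to the
   change of density [w] is controlled by the L_1-norm. *)
Definition density_good (w : R -> R) (L : R) (f : R -> R) : Prop :=
  [/\ measurable_fun setT f, mu.-integrable setT (EFin \o f) &
    (\int[mu]_t (`|f t / w t| `^ r * w t)%:E <= ((L * munorm f) `^ r)%:E)%E].

Let e' i : R -> R := (e i) \_ I01.

Let me' i : inN N i -> measurable_fun setT (e' i).
Proof.
move=> Ni; apply/(measurable_restrictT _ _).1; first exact: measurable_I01.
by case: (ei Ni).
Qed.

(** The n-th partial sum of sum_i e_i(s) x_i(t), pulled back to [0,1] along [phi]. Each [e i] is cut
    to [0,1] to be measurable on the whole line. *)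
Definition tens (phi : R -> R * R) (x : nat -> R -> R) (n : nat) (u : R) : R :=
  \sum_(i < n | inN N i) (e i \_ I01) (phi u).1 * x i (phi u).2.

Let tens2 (x : nat -> R -> R) (n : nat) (z : R * R) : R :=
  \sum_(i < n | inN N i) e' i z.1 * x i z.2.

Let mtens2 x n : (forall i, inN N i -> measurable_fun setT (x i)) ->
  measurable_fun setT (tens2 x n).
Proof.
move=> mx; apply: measurable_sum_cond => i Ni; apply: measurable_funM.
  exact: (measurableT_comp (me' Ni)).
exact: (measurableT_comp (mx _ Ni)).
Qed.

Lemma munorm_ge0 f : 0 <= munorm f.
Proof. by apply: fine_ge0; apply: integral_ge0 => t _; rewrite lee_fin. Qed.

Lemma EFin_munorm f : mu.-integrable setT (EFin \o f) ->
  (munorm f)%:E = (\int[mu]_t (`|f t|)%:E)%E.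
Proof.
move=> fi; rewrite /munorm fineK//; apply: integrable_fin_num => //.
exact: integrable_norm fi.
Qed.

Let section_norm (c : nat -> R) n :
  (\int[unif]_s (`|\sum_(i < n | inN N i) e' i s * c i|)%:E = (snorm N e c n)%:E)%E.
Proof.
rewrite integral_unif//; last first.
  apply/measurable_EFinP; apply: measurableT_comp => //.
  by apply: measurable_sum_cond => i Ni; apply: measurable_funM => //; exact: me'.
rewrite /snorm EFin_L1norm; last exact: isL1_psum.
apply: eq_integral => s Is; congr (`|_|%:E); apply: eq_bigr => i _.
by rewrite /e' patchE Is mulrC.
Qed.

Let integral_tens2 x n : (forall i, inN N i -> measurable_fun setT (x i)) ->
  (\int[unif \x mu]_z (`|tens2 x n z|)%:E = \int[mu]_t (snorm N e (x ^~ t) n)%:E)%E.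
Proof.
move=> mx; rewrite fubini_tonelli2//=; last first.
  by apply/measurable_EFinP; apply: measurableT_comp => //; exact: mtens2.
by apply: eq_integral => t _; rewrite -section_norm.
Qed.

(** By unconditionality each x_i may be replaced by |x_i|. For fixed s, the integral over t of the
    modulus of sum_i e_i(s) |x_i(t)| then dominates the modulus of sum_i e_i(s) ||x_i||. *)
Let integral_lower x n : (forall i, inN N i -> mu.-integrable setT (EFin \o x i)) ->
  ((snorm N e (munorm \o x) n)%:E <= \int[mu]_t (snorm N e (x ^~ t) n)%:E)%E.
Proof.
move=> xi.
have mx i : inN N i -> measurable_fun setT (x i).
  by move=> /xi /measurable_int/measurable_EFinP.
pose ax i t := `|x i t|.
have max i : inN N i -> measurable_fun setT (ax i).
  by move=> Ni; apply: measurableT_comp => //; exact: mx.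
have -> : (\int[mu]_t (snorm N e (x ^~ t) n)%:E =
    \int[mu]_t (snorm N e (ax ^~ t) n)%:E)%E.
  by apply: eq_integral => t _; rewrite -(snorm_absE Hu).
rewrite -(integral_tens2 _ max) fubini_tonelli1//=; last first.
  by apply/measurable_EFinP; apply: measurableT_comp => //; exact: mtens2.
rewrite -section_norm; apply: ge0_le_integral => //.
- apply/measurable_EFinP; apply: measurableT_comp => //.
  by apply: measurable_sum_cond => i Ni; apply: measurable_funM => //; exact: me'.
- apply: (@measurable_fun_fubini_tonelli_F _ _ _ _ _ mu _ _ _) => //.
  by apply/measurable_EFinP; apply: measurableT_comp => //; exact: mtens2.
move=> s _; rewrite /fubini_F/=.
pose c i := if inN N i then e' i s else 0.
pose y i : R -> R := if inN N i then x i else fun=> 0.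
have yi i : mu.-integrable setT (fun t => (`|y i t|)%:E).
  apply: (integrable_norm (f := y i)) => //; rewrite /y; case: ifPn => [/xi//|_].
  exact: integrable0.
have E : (\sum_(i < n | inN N i) e' i s * (munorm \o x) i)%:E =
    (\int[mu]_t (\sum_(i < n | inN N i) (e' i s * ax i t)%:E))%E.
  transitivity (\int[mu]_t (\sum_(i < n) ((c i)%:E * (`|y i t|)%:E)))%E; last first.
    apply: eq_integral => t _; rewrite [RHS]big_mkcond; apply: eq_bigr => i _.
    by rewrite /c /y /ax; case: (inN N i); rewrite -?EFinM// normr0 mulr0.
  rewrite integral_sum//; last by move=> i; exact: integrableZl.
  rewrite big_mkcond -sumEFin; apply: eq_bigr => i _; rewrite integralZl// /c /y.
  by case: ifPn => Ni; rewrite ?mul0e// EFinM EFin_munorm//; exact: xi.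
rewrite -abse_EFin E; apply: le_trans (le_abse_integral mu measurableT _) _.
  under eq_fun do rewrite sumEFin; apply/measurable_EFinP.
  by apply: measurable_sum_cond => i Ni; apply: measurable_funM => //; exact: max.
rewrite le_eqVlt; apply/orP; left; apply/eqP; apply: eq_integral => t _.
by rewrite sumEFin.
Qed.

Variables (w : R -> R) (L : R).
Hypothesis mw : measurable_fun setT w.
Hypothesis w0 : forall t, 0 < w t.
Hypothesis w1 : (\int[mu]_t (w t)%:E = 1)%E.
Hypothesis L0 : 0 <= L.

(** Homogeneity extracts the density: the norm of (x_i(t))_i is [w t] times the norm of (x_i(t) /
    w(t))_i. The integral form of concavity applies to the probability w dmu with [D i] equal to L
    ||x_i||. *)
Let integral_upper x n : (forall i, inN N i -> density_good w L (x i)) ->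
  (\int[mu]_t (snorm N e (x ^~ t) n)%:E <= (`|K| * L * snorm N e (munorm \o x) n)%:E)%E.
Proof.
move=> xg.
have mxw i : inN N i -> measurable_fun setT (fun t => x i t / w t).
  move=> Ni; have [mx _ _] := xg i Ni; apply: measurable_funM => //.
  rewrite (_ : (fun t => (w t)^-1) = (fun t => w t `^ (-1))).
    exact: (measurableT_comp (measurable_powR (-1)) mw).
  by apply/funext => t; rewrite powR_inv1// ltW.
have -> : (\int[mu]_t (snorm N e (x ^~ t) n)%:E =
    \int[mu]_t (snorm N e (fun i => x i t / w t) n * w t)%:E)%E.
  apply: eq_integral => t _; congr (_%:E).
  transitivity (`|w t| * snorm N e (fun i => x i t / w t) n); last first.
    by rewrite gtr0_norm// mulrC.
  rewrite -snormZ//; apply: eq_snorm => i _ _.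
  by rewrite mulrC divfK// gt_eqF.
rewrite -mulrA -[X in `|K| * (X * _)](ger0_norm L0) -snormZ//.
apply: (integral_concave mw (fun t => ltW (w0 t)) w1 ei Hu r1 rc).
- by move=> i _; exact: mxw.
- by move=> i; rewrite mulr_ge0// munorm_ge0.
- by move=> i _ Ni; have [_ _] := xg i Ni.
Qed.

Lemma tens_bounds (phi : R -> R * R) x n : measurable_fun setT phi ->
  (forall h : R * R -> \bar R, measurable_fun setT h -> (forall z, (0 <= h z)%E) ->
    (\int[lam]_(u in I01) h (phi u) = \int[unif \x mu]_z h z)%E) ->
  (forall i, inN N i -> density_good w L (x i)) ->
  isL1 (tens phi x n) /\ snorm N e (munorm \o x) n <= L1norm (tens phi x n) <=
    `|K| * L * snorm N e (munorm \o x) n.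
Proof.
move=> mphi phiE xg.
have mx i : inN N i -> measurable_fun setT (x i) by case/(xg i).
have xi i : inN N i -> mu.-integrable setT (EFin \o x i) by case/(xg i).
have mtens : measurable_fun setT (tens phi x n).
  exact: (measurableT_comp (mtens2 n mx) mphi).
have E : (\int[lam]_(u in I01) (`|tens phi x n u|)%:E =
    \int[mu]_t (snorm N e (x ^~ t) n)%:E)%E.
  rewrite -(integral_tens2 n mx) -(phiE (fun z => (`|tens2 x n z|)%:E))//.
  by apply/measurable_EFinP; apply: measurableT_comp => //; exact: mtens2.
have up := integral_upper n xg; have lo := integral_lower n xi.
have ti : isL1 (tens phi x n).
  apply/isL1P/integrableP; split.
    by apply/measurable_EFinP; apply: measurable_funTS.
  change (\int[lam]_(u in I01) (`|tens phi x n u|)%:E < +oo)%E.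
  by rewrite E; apply: le_lt_trans up (ltry _).
split=> //; rewrite -E -EFin_L1norm// in up lo.
by rewrite -!lee_fin lo up.
Qed.

Lemma tens_tail phi x m n : (m <= n)%N -> tens phi x n \- tens phi x m =
  tens phi (fun i t => if (m <= i)%N then x i t else 0) n.
Proof.
move=> mn; apply/funext => u.
(* [psum_tail] is applied to constant functions, whose values are those of the [e i] at the first
   coordinate of [phi u]; the coefficients are the numbers [x i (phi u).2]. *)
have := @psum_tail _ N (fun i _ => (e i \_ I01) (phi u).1) (fun i => x i (phi u).2) m n mn.
move=> /(congr1 (@^~ 0)) /=; rewrite /psum /tens => H.
transitivity (\sum_(i < n | inN N i) x i (phi u).2 * (e i \_ I01) (phi u).1 -
  \sum_(i < m | inN N i) x i (phi u).2 * (e i \_ I01) (phi u).1).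
  by congr (_ - _); apply: eq_bigr => i _; rewrite mulrC.
by rewrite H; apply: eq_bigr => i _; rewrite mulrC; case: ifP => _.
Qed.

Lemma density_good0 : density_good w L (fun=> 0).
Proof.
split=> //; first exact: integrable0.
under eq_integral do rewrite mul0r normr0 powR0 ?gt_eqF ?(lt_le_trans ltr01)// mul0r.
by rewrite integral0 lee_fin powR_ge0.
Qed.

(** [X v] gives the coordinates of [v]. In the matrix space they are chosen representatives, so
    linearity of [X] is required only up to functions of norm 0; these are asked to be
    [density_good], so that the upper tensor bound annihilates them. The summand 1 makes the
    constant positive. *)
Lemma embeds_tens (V : Type) (S : set V) (lin : R -> V -> R -> V -> V)
    (nrm : V -> R -> Prop) (X : V -> nat -> R -> R) :
  (forall v, S v -> forall i, inN N i -> density_good w L (X v i)) ->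
  (forall a v b z, S v -> S z -> forall i, inN N i ->
     density_good w L (X (lin a v b z) i) /\
     density_good w L (fun t => X (lin a v b z) i t - (a * X v i t + b * X z i t)) /\
     munorm (fun t => X (lin a v b z) i t - (a * X v i t + b * X z i t)) = 0) ->
  (forall v, S v -> exists g, L1cvg (psum N (munorm \o X v) e) g) ->
  (forall v c, S v -> nrm v c ->
     exists g, L1cvg (psum N (munorm \o X v) e) g /\ c = L1norm g) ->
  embeds_L1 S lin nrm (`|K| * L + 1).
Proof.
move=> Xg Xlin Xcv Xnrm; have [phi [mphi phiE]] := lebesgue_transport mu.
have C0 : 0 <= `|K| * L by rewrite mulr_ge0.
have le1 c : 0 <= c -> `|K| * L * c <= (`|K| * L + 1) * c.
  by move=> c0; rewrite ler_wpM2r// lerDl.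
apply: (@embeds_L1_of_partial _ _ S lin nrm
  (fun v n => tens phi (X v) n) (fun v n => psum N (munorm \o X v) e n)) => //.
- by rewrite ltr_wpDl.
- by move=> v n Sv; have [] := @tens_bounds phi (X v) n mphi phiE (Xg v Sv).
- by move=> v n Sv; exact: isL1_psum.
- move=> v m n Sv mn; rewrite tens_tail// psum_tail//.
  have [|_ /andP[_]] := @tens_bounds phi
      (fun i t => if (m <= i)%N then X v i t else 0) n mphi phiE.
    by move=> i Ni; case: (m <= i)%N; [exact: Xg|exact: density_good0].
  move=> /le_trans; apply; apply: le_trans (le1 _ (L1norm_ge0 _)).
  apply: ler_wpM2l => //; rewrite le_eqVlt; apply/orP; left; apply/eqP.
  apply: eq_snorm => i _ _ /=; case: ifP => // _.
  by rewrite /munorm; under eq_integral do rewrite normr0; rewrite integral0.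
- move=> v n Sv; have [_ /andP[-> h]] := @tens_bounds phi (X v) n mphi phiE (Xg v Sv).
  by rewrite /= (le_trans h)// le1// snorm_ge0.
move=> a v b z n Sv Sz; split.
  have [] // := @tens_bounds phi (X (lin a v b z)) n mphi phiE.
  by move=> i Ni; have [] := Xlin a v b z Sv Sz i Ni.
pose Y i t := X (lin a v b z) i t - (a * X v i t + b * X z i t).
have [|_ /andP[_]] := @tens_bounds phi Y n mphi phiE.
  by move=> i Ni; have [_ []] := Xlin a v b z Sv Sz i Ni.
have -> : snorm N e (munorm \o Y) n = 0.
  rewrite (@eq_snorm _ N e _ (fun=> 0)).
    rewrite /snorm (@eq_L1norm _ _ (fun=> 0)) ?L1norm0// => t _.
    by rewrite /psum big1// => i _; rewrite mul0r.
  by move=> i _ Ni; have [_ []] := Xlin a v b z Sv Sz i Ni.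
rewrite mulr0 => h; apply/eqP; rewrite eq_le L1norm_ge0 andbT.
congr (_ <= 0) : h; apply: eq_L1norm => u _.
rewrite /tens /= !mulr_sumr -big_split -sumrB/=; apply: eq_bigr => i _.
by rewrite /Y; ring.
Qed.

End tensor.

(** * The embedding of the space of X-valued sequences *)

Section sumspace.
Context {R : realType}.

Lemma L1muE (mu : probability R R) (f : R -> R) : L1mu mu f = munorm mu f.
Proof. by rewrite /L1mu Lnorm1. Qed.

Lemma density_good_Lnorm (mu : probability R R) (r K : R) (f : R -> R) :
  1 <= r -> measurable_fun setT f -> mu.-integrable setT (EFin \o f) ->
  ('N[mu]_(r%:E)[EFin \o f] <= K%:E * 'N[mu]_1[EFin \o f])%E ->
  density_good r mu (fun=> 1) `|K| f.
Proof.
move=> r1 mf fi fK; split=> //.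
have r0 : 0 < r by exact: lt_le_trans ltr01 r1.
have -> : (\int[mu]_t (`|f t / 1| `^ r * 1)%:E = \int[mu]_t (`|(EFin \o f) t| `^ r))%E.
  by apply: eq_integral => t _ /=; rewrite divr1 mulr1.
rewrite -(poweR_Lnorm mu (EFin \o f) (lt0r_neq0 r0)) -poweR_EFin.
apply: gt0_ler_poweR; rewrite ?(ltW r0)//.
- by rewrite in_itv/= Lnorm_ge0 leey.
- by rewrite in_itv/= lee_fin mulr_ge0 ?munorm_ge0// leey.
apply: le_trans fK _; rewrite Lnorm1 EFinM EFin_munorm//.
apply: lee_wpmul2r; first by apply: integral_ge0.
by rewrite lee_fin ler_norm.
Qed.

Lemma sumspace_embeds (r K1 K2 : R) (N : option nat) (e : nat -> R -> R)
    (mu : probability R R) (X : set (R -> R)) : 1 <= r ->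
  (forall i, inN N i -> isL1 (e i)) -> one_unconditional N e -> r_concave N e r K1 ->
  L1mu_subspace mu X ->
  (forall x, X x -> ('N[mu]_(r%:E)[EFin \o x] <= K2%:E * 'N[mu]_1[EFin \o x])%E) ->
  embeds_L1 (in_sumspace N e mu X) (@lin_seq R) (sumspace_norm N e mu)
    (`|K1| * `|K2| + 1).
Proof.
move=> r1 ei Hu rc [X0 [Xlin Xi]] XK.
have w1 : (\int[mu]_t (1 : R)%:E = 1)%E by rewrite integral_cst// mul1e; exact: probability_setT.
have Xg x : X x -> density_good r mu (fun=> 1) `|K2| x.
  by move=> Xx; have [mx xi] := Xi x Xx; apply: density_good_Lnorm => //; exact: XK.
have cE v : (fun i => L1mu mu (v i)) = munorm mu \o v.
  by apply/funext => i; exact: L1muE.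
apply: (@embeds_tens _ N e r K1 ei Hu r1 rc mu (fun=> 1) `|K2| _ _ w1 _ _ _ _ _ id) => //.
- by move=> v [Xv _] i Ni; exact/Xg/Xv.
- move=> a v b z [Xv _] [Xz _] i Ni; split.
    by apply: Xg; apply: Xlin; [exact: Xv|exact: Xz].
  have -> : (fun t => lin_seq a v b z i t - (a * v i t + b * z i t)) = fun=> 0.
    by apply/funext => t; rewrite /lin_seq subrr.
  split; first exact: density_good0.
  by rewrite /munorm; under eq_integral do rewrite normr0; rewrite integral0.
- by move=> v [_ [_ [c [g [vg _]]]]]; exists g; rewrite -cE.
- by move=> v c _ [g [vg ->]]; exists g; rewrite -cE.
Qed.

End sumspace.

(** * Random signs *)

Section sign_averages.
Context {R : realType}.
Implicit Types (h g : (nat -> R) -> R) (c s : nat -> R).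

Definition upd s (m : nat) (x : R) : nat -> R := fun i => if i == m then x else s i.

Fixpoint avg (m : nat) h : R :=
  if m is m'.+1 then
    (avg m' (fun s => h (upd s m' 1)) + avg m' (fun s => h (upd s m' (-1)))) / 2
  else h (fun=> 1).

Lemma avg_le m h g : (forall s, (forall i, `|s i| = 1) -> h s <= g s) ->
  avg m h <= avg m g.
Proof.
elim: m h g => [|m IH] h g hg /=; first by apply: hg => i; rewrite normr1.
rewrite ler_pM2r ?invr_gt0//; apply: lerD; apply: IH => s s1; apply: hg => i;
  by rewrite /upd; case: eqP => // _; rewrite ?normrN normr1.
Qed.

Lemma eq_avg m h g : (forall s, (forall i, `|s i| = 1) -> h s = g s) ->
  avg m h = avg m g.
Proof.
by move=> hg; apply/eqP; rewrite eq_le !avg_le// => s /hg ->.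
Qed.

Lemma avg_lin m a h b g : avg m (fun s => a * h s + b * g s) = a * avg m h + b * avg m g.
Proof. by elim: m h g => //= m IH h g; rewrite !IH; field. Qed.

Lemma avg_cst m x : avg m (fun=> x) = x.
Proof. by elim: m => //= m ->; field. Qed.

Lemma avg_sum m (I : Type) (r : seq I) (P : pred I) (F : I -> (nat -> R) -> R) :
  avg m (fun s => \sum_(i <- r | P i) F i s) = \sum_(i <- r | P i) avg m (F i).
Proof.
elim: r => [|i r IH]; first by rewrite big_nil -[RHS](avg_cst m);
  apply: eq_avg => s _; rewrite big_nil.
rewrite big_cons -IH; case: ifPn => Pi; last first.
  by apply: eq_avg => s _; rewrite big_cons (negbTE Pi).
rewrite -[X in X + _]mul1r -[X in _ + X]mul1r -avg_lin.
by apply: eq_avg => s _; rewrite big_cons Pi !mul1r.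
Qed.

Lemma avg_ge0 m h : (forall s, 0 <= h s) -> 0 <= avg m h.
Proof. by move=> h0; rewrite -(avg_cst m 0); exact: avg_le. Qed.

(** The variance is nonnegative. *)
Lemma sqr_avg_le m h : avg m h ^+ 2 <= avg m (fun s => h s ^+ 2).
Proof.
set a := avg m h; rewrite -subr_ge0.
have -> : avg m (fun s => h s ^+ 2) - a ^+ 2 =
    avg m (fun s => (h s - a) ^+ 2).
  transitivity (1 * avg m (fun s => h s ^+ 2) + 1 * ((- (2 * a)) * avg m h +
     1 * avg m (fun=> a ^+ 2))).
    by rewrite avg_cst -/a; ring.
  rewrite -avg_lin -avg_lin; apply: eq_avg => s _; ring.
by apply: avg_ge0 => s; exact: sqr_ge0.
Qed.

Lemma avg_le_sqrt m h : avg m h <= Num.sqrt (avg m (fun s => h s ^+ 2)).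
Proof.
apply: le_trans (ler_norm _) _; rewrite -sqrtr_sqr ler_sqrt ?sqr_avg_le//.
by apply: avg_ge0 => s; exact: sqr_ge0.
Qed.

Definition ssum m c s : R := \sum_(i < m) s i * c i.

Lemma ssum_upd m c s x : ssum m.+1 c (upd s m x) = ssum m c s + x * c m.
Proof.
rewrite /ssum big_ord_recr/= {2}/upd eqxx; congr (_ + _); apply: eq_bigr => i _.
by rewrite /upd ltn_eqF.
Qed.

Lemma avg_ssum2 m c : avg m (fun s => ssum m c s ^+ 2) = \sum_(i < m) c i ^+ 2.
Proof.
elim: m => [|m IH]; first by rewrite /= /ssum !big_ord0 expr0n.
rewrite big_ord_recr/= -IH.
rewrite (@eq_avg m _ (fun s => 1 * ssum m c s ^+ 2 + 1 * (2 * c m * ssum m c s + 1 * c m ^+ 2))).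
  rewrite (@eq_avg m (fun s => ssum m.+1 c (upd s m (-1)) ^+ 2)
    (fun s => 1 * ssum m c s ^+ 2 + 1 * (- (2 * c m) * ssum m c s + 1 * c m ^+ 2))).
    by rewrite !avg_lin avg_cst; field.
  by move=> s _; rewrite ssum_upd; ring.
by move=> s _; rewrite ssum_upd; ring.
Qed.

(** With second moment M, a further signed coefficient c adds 6 c^2 M + c^4 to the fourth moment,
    the odd terms cancelling, whereas 3 M^2 grows by 6 c^2 M + 3 c^4. *)
Lemma avg_ssum4 m c :
  avg m (fun s => ssum m c s ^+ 4) <= 3 * (\sum_(i < m) c i ^+ 2) ^+ 2.
Proof.
elim: m => [|m IH]; first by rewrite /= /ssum !big_ord0 !expr0n mulr0.
rewrite big_ord_recr/=; set M := \sum_(i < m) _.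
have -> : (avg m (fun s => ssum m.+1 c (upd s m 1) ^+ 4) +
    avg m (fun s => ssum m.+1 c (upd s m (-1)) ^+ 4)) / 2 =
    avg m (fun s => ssum m c s ^+ 4) + 6 * c m ^+ 2 * M + c m ^+ 4.
  transitivity (2^-1 * avg m (fun s => ssum m.+1 c (upd s m 1) ^+ 4) +
    2^-1 * avg m (fun s => ssum m.+1 c (upd s m (-1)) ^+ 4)); first by field.
  rewrite -avg_lin /M -avg_ssum2.
  transitivity (1 * avg m (fun s => ssum m c s ^+ 4) + 1 * ((6 * c m ^+ 2) *
    avg m (fun s => ssum m c s ^+ 2) + 1 * avg m (fun=> c m ^+ 4))); last first.
    by rewrite avg_cst; ring.
  rewrite -!avg_lin; by apply: eq_avg => s _; rewrite !ssum_upd; field.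
have c2 := sqr_ge0 (c m ^+ 2).
have -> : 3 * (M + c m ^+ 2) ^+ 2 = 3 * M ^+ 2 + 6 * c m ^+ 2 * M + c m ^+ 4 +
  2 * (c m ^+ 2) ^+ 2 by ring.
rewrite -/M in IH; lra.
Qed.

(* From [2 |y| >= 3 y^2 - y^4] at [y = S / (2 sigma)]. *)
Lemma khintchine m c :
  Num.sqrt (\sum_(i < m) c i ^+ 2) <= 2 * avg m (fun s => `|ssum m c s|).
Proof.
set M := \sum_(i < m) c i ^+ 2; set sg := Num.sqrt M.
have M0 : 0 <= M by apply: sumr_ge0 => i _; exact: sqr_ge0.
have [s0|sn0] := eqVneq sg 0.
  by rewrite s0 mulr_ge0// avg_ge0.
have sp : 0 < sg by rewrite lt_neqAle eq_sym sn0 sqrtr_ge0.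
have sgM : sg ^+ 2 = M by rewrite sqr_sqrtr.
have pt s : 3 / (2 * sg) * ssum m c s ^+ 2 +
    (- (8 * sg ^+ 3)^-1) * (1 * ssum m c s ^+ 4 + 0 * 1) <= 2 * `|ssum m c s|.
  set y := `|ssum m c s| / (2 * sg).
  have y0 : 0 <= y by rewrite divr_ge0// mulr_ge0// ltW.
  have yE : `|ssum m c s| = y * (2 * sg) by rewrite divfK// mulf_neq0.
  have E2 : ssum m c s ^+ 2 = (y * (2 * sg)) ^+ 2 by rewrite -yE real_normK// num_real.
  have E4 : ssum m c s ^+ 4 = (y * (2 * sg)) ^+ 4.
    by rewrite -[4%N]/(2 * 2)%N !exprM E2.
  rewrite E2 E4 yE.
  have -> : 3 / (2 * sg) * (y * (2 * sg)) ^+ 2 + - (8 * sg ^+ 3)^-1 *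
    (1 * (y * (2 * sg)) ^+ 4 + 0 * 1) = sg * (6 * y ^+ 2 - 2 * y ^+ 4) by field.
  have -> : 2 * (y * (2 * sg)) = sg * (2 * y + 2 * y) by ring.
  rewrite ler_pM2l//.
  have : 0 <= y * ((y - 1) ^+ 2 * (y + 2)).
    by apply: mulr_ge0 => //; apply: mulr_ge0; [exact: sqr_ge0|exact: addr_ge0].
  have -> : y * ((y - 1) ^+ 2 * (y + 2)) = 2 * y - 3 * y ^+ 2 + y ^+ 4 by ring.
  lra.
have := @avg_le m _ _ (fun s _ => pt s).
rewrite !avg_lin avg_cst avg_ssum2 -/M.
have -> : avg m (fun s => 2 * `|ssum m c s|) = 2 * avg m (fun s => `|ssum m c s|).
  rewrite -[RHS]addr0 -[X in _ + X](mul0r (avg m (fun=> 0))) -avg_lin.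
  by apply: eq_avg => s _; rewrite mulr0 addr0.
apply: le_trans; have := avg_ssum4 m c; rewrite -/M -sgM => h4.
have h5 : (8 * sg ^+ 3)^-1 * avg m (fun s => ssum m c s ^+ 4) <=
    (8 * sg ^+ 3)^-1 * (3 * (sg ^+ 2) ^+ 2).
  by rewrite ler_wpM2l// invr_ge0 mulr_ge0// exprn_ge0// ltW.
(* The two moments leave (3/2 - 3/8) sg = (9/8) sg, which exceeds the required sg. *)
have E : (8 * sg ^+ 3)^-1 * (3 * (sg ^+ 2) ^+ 2) = 3 / 8 * sg by field.
have E' : 3 / (2 * sg) * sg ^+ 2 = 3 / 2 * sg by field.
set A := avg m _ in h5 *.
have -> : - (8 * sg ^+ 3)^-1 * (1 * A + 0 * 1) = - ((8 * sg ^+ 3)^-1 * A) by ring.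
rewrite E'; rewrite E in h5; lra.
Qed.

(** Both x and y are half sums or half differences of y + x and y - x, so averaging over one sign
    dominates each modulus. Hence the largest |c_j| lies below the averaged signed sum. *)
Lemma le_avg_ssum m c j : (j < m)%N -> `|c j| <= avg m (fun s => `|ssum m c s|).
Proof.
elim: m => // m IH; rewrite ltnS => jm /=.
have h (x y : R) : `|x| <= (`|y + 1 * x| + `|y + -1 * x|) / 2.
  rewrite ler_pdivlMr//; have := ler_normB (y + 1 * x) (y + -1 * x).
  by rewrite (_ : _ - _ = x * 2) ?normrM ?(ger0_norm (_ : 0 <= 2))//; ring.
have h' (x y : R) : `|y| <= (`|y + 1 * x| + `|y + -1 * x|) / 2.
  rewrite ler_pdivlMr//; have := ler_normD (y + 1 * x) (y + -1 * x).
  by rewrite (_ : _ + _ = y * 2) ?normrM ?(ger0_norm (_ : 0 <= 2))//; ring.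
have -> : (avg m (fun s => `|ssum m.+1 c (upd s m 1)|) +
    avg m (fun s => `|ssum m.+1 c (upd s m (-1))|)) / 2 =
    avg m (fun s => (`|ssum m c s + 1 * c m| + `|ssum m c s + -1 * c m|) / 2).
  transitivity (2^-1 * avg m (fun s => `|ssum m.+1 c (upd s m 1)|) +
    2^-1 * avg m (fun s => `|ssum m.+1 c (upd s m (-1))|)); first by field.
  by rewrite -avg_lin; by apply: eq_avg => s _; rewrite !ssum_upd; field.
move: jm; rewrite leq_eqVlt => /predU1P[->|jm].
  by rewrite -[leLHS](avg_cst m); apply: avg_le => s _; exact: h.
by apply: le_trans (IH jm) _; apply: avg_le => s _; exact: h'.
Qed.

Lemma L1norm_avg m (F : (nat -> R) -> R -> R) : (forall s, isL1 (F s)) ->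
  isL1 (fun t => avg m (fun s => `|F s t|)) /\
  L1norm (fun t => avg m (fun s => `|F s t|)) = avg m (fun s => L1norm (F s)).
Proof.
elim: m F => [|m IH] F Fi /=.
  by split; [exact: isL1_abs|rewrite L1norm_abs].
have [i1 e1] := IH (fun s => F (upd s m 1)) (fun s => Fi _).
have [i2 e2] := IH (fun s => F (upd s m (-1))) (fun s => Fi _).
split.
  by apply: eq_isL1 (isL1_lin 2^-1 2^-1 i1 i2) => t; field.
rewrite -e1 -e2.
set f1 := fun t => avg m (fun s => `|F (upd s m 1) t|) in i1 e1 *.
set f2 := fun t => avg m (fun s => `|F (upd s m (-1)) t|) in i2 e2 *.
have f10 t : 0 <= f1 t by exact: avg_ge0.
have f20 t : 0 <= f2 t by exact: avg_ge0.
rewrite (@eq_L1norm _ _ (fun t => 2^-1 * (f1 t + f2 t))); last by move=> t _; exact: mulrC.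
rewrite L1normZ; last exact: isL1D.
rewrite ger0_norm ?invr_ge0// mulrC; congr (_ / _).
have mI := @measurable_I01 R.
rewrite !L1normE -RintegralD//; [|exact: isL1_norm..].
by apply: eq_Rintegral => t _; rewrite !ger0_norm ?addr_ge0.
Qed.

End sign_averages.

(** * The maximal inequality for p-convex sequences *)

Section maximal_estimate.
Context {R : realType}.
Variables (N : option nat) (f : nat -> R -> R) (p K : R).
Hypothesis fi : forall i, inN N i -> isL1 (f i).
Hypothesis Hu : one_unconditional N f.
Hypothesis p1 : 1 < p.
Hypothesis p2 : p <= 2.
Hypothesis pc : p_convex N f p K.

Let p0 : 0 < p. Proof. exact: lt_trans ltr01 p1. Qed.

(** Every |a_k| is at most [A], so |a_k|^2 <= A^(2-p) |a_k|^p because p <= 2; summing gives A^2. *)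
Lemma sqrt_sum_sqr_le (n : nat) (a : nat -> R) :
  Num.sqrt (\sum_(k < n) a k ^+ 2) <= (\sum_(k < n) `|a k| `^ p) `^ p^-1.
Proof.
set S := \sum_(k < n) `|a k| `^ p; set A := S `^ p^-1.
have S0 : 0 <= S by apply: sumr_ge0 => k _; exact: powR_ge0.
have A0 : 0 <= A by exact: powR_ge0.
have ApS : A `^ p = S by rewrite powRVK ?gt_eqF.
have sq (x : R) : 0 <= x -> x ^+ 2 = x `^ (2 - p) * x `^ p.
  by move=> x0; rewrite -powRD ?subrK ?powR_mulrn// pnatr_eq0.
have aA (k : 'I_n) : `|a k| <= A.
  rewrite -[leLHS](@powRKV _ p) ?gt_eqF//.
  apply: ler_powR2r; rewrite ?invr_ge0 ?(ltW p0) ?powR_ge0//.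
  rewrite /S (bigD1 k)//= lerDl; apply: sumr_ge0 => i _; exact: powR_ge0.
rewrite -[leRHS](ger0_norm A0) -sqrtr_sqr ler_sqrt ?sqr_ge0//.
rewrite (sq A A0) ApS /S mulr_sumr; apply: ler_sum => k _.
rewrite -real_normK ?num_real// (sq _ (normr_ge0 _)).
apply: ler_wpM2r; first exact: powR_ge0.
by apply: ler_powR2r; rewrite ?subr_ge0.
Qed.

Let rowc (c : nat -> R) t (l : nat) : R := if inN N l then c l * f l t else 0.

Let psum_ssum M (d c : nat -> R) t :
  psum N (fun l => d l * c l) f M t = ssum M (rowc c t) d.
Proof.
rewrite /psum /ssum big_mkcond; apply: eq_bigr => l _; rewrite /rowc.
by case: ifP => _; rewrite ?mulr0// mulrA.
Qed.

Let snorm_signs M (c d : nat -> R) : (forall i, `|d i| = 1) ->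
  snorm N f (fun l => d l * c l) M = snorm N f c M.
Proof.
by move=> d1; apply/eqP; rewrite eq_le !Hu// => i _; rewrite normrM d1 mul1r.
Qed.

(** All sign changes of the coefficients give the same norm, which is thus its own average; the
    average then moves inside the integral. *)
Let snorm_avg M (c : nat -> R) : snorm N f c M =
  L1norm (fun t => avg M (fun d => `|ssum M (rowc c t) d|)).
Proof.
have [_ E] := @L1norm_avg _ M (fun d => psum N (fun l => d l * c l) f M)
  (fun d => isL1_psum fi _ _).
transitivity (avg M (fun d => L1norm (psum N (fun l => d l * c l) f M))).
  rewrite -[LHS](avg_cst M); apply: eq_avg => d d1.
  by rewrite -(snorm_signs M c d1).
by rewrite -E; apply: eq_L1norm => t _; apply: eq_avg => d _; rewrite psum_ssum.
Qed.

Let isL1_avg M (c : nat -> R) : isL1 (fun t => avg M (fun d => `|ssum M (rowc c t) d|)).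
Proof.
have [i1 _] := @L1norm_avg _ M (fun d => psum N (fun l => d l * c l) f M)
  (fun d => isL1_psum fi _ _).
by apply: eq_isL1 i1 => t; apply: eq_avg => d _; rewrite psum_ssum.
Qed.

(* Both signs are averaged: those of the family, then, by unconditionality,
   those of the coordinates; Khintchine turns the resulting square function
   back into a norm of the sequence. *)
Lemma maximal_estimate (n M : nat) (a : nat -> nat -> R) (h : R -> R) : isL1 h ->
  (forall t, `|h t| <= avg n (fun s => `|\sum_(k < n) s k * psum N (a k) f M t|)) ->
  L1norm h <= 2 * (`|K| * (\sum_(k < n) snorm N f (a k) M `^ p) `^ p^-1).
Proof.
move=> hi hle.
pose b (s : nat -> R) l := ssum n (fun k => a k l) s.
have bE (s : nat -> R) t : \sum_(k < n) s k * psum N (a k) f M t = psum N (b s) f M t.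
  rewrite /psum /b /ssum; under [RHS]eq_bigr do rewrite mulr_suml.
  rewrite [RHS]exchange_big; apply: eq_bigr => k _; rewrite mulr_sumr.
  by apply: eq_bigr => l _; rewrite mulrA.
pose Z s t := avg M (fun d => `|ssum M (rowc (b s) t) d|).
have Z0 s t : 0 <= Z s t by exact: avg_ge0.
(* The square function of the family, coordinate by coordinate. *)
pose d l := Num.sqrt (\sum_(k < n) a k l ^+ 2).
have [Fi Fe] := @L1norm_avg _ n (fun s => psum N (b s) f M)
  (fun s => isL1_psum fi _ _).
have [Zi Ze] := @L1norm_avg _ n Z (fun s => isL1_avg M (b s)).
apply: (@le_trans _ _ (avg n (fun s => snorm N f (b s) M))).
  rewrite -Fe; apply: L1norm_le => // t _; apply: le_trans (hle t) _.
  apply: le_trans (ler_norm _); apply: avg_le => s _.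
  by rewrite bE.
rewrite (@eq_avg _ n _ (fun s => L1norm (Z s))); last by move=> s _; rewrite snorm_avg.
rewrite -Ze; apply: (@le_trans _ _ (2 * snorm N f d M)).
  rewrite snorm_avg -[X in X * _](ger0_norm (_ : 0 <= 2))//.
  rewrite -L1normZ; last exact: isL1_avg.
  apply: L1norm_le => //; first by apply: isL1Z; exact: isL1_avg.
  move=> t _; rewrite [leLHS]ger0_norm ?avg_ge0//.
  rewrite [leRHS]ger0_norm ?mulr_ge0 ?avg_ge0//.
  (* Khintchine serves the signs of the coordinates. The signs of the family are removed by
     orthogonality: the mean of [b s l ^+ 2] is [d l ^+ 2]. *)
  apply: le_trans (khintchine M (rowc d t)).
  apply: le_trans (avg_le_sqrt _ _) _; rewrite ler_sqrt; last first.
    by apply: sumr_ge0 => l _; exact: sqr_ge0.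
  apply: (@le_trans _ _ (avg n (fun s => \sum_(l < M) (rowc (b s) t l) ^+ 2))).
    apply: avg_le => s _; rewrite real_normK ?num_real//.
    rewrite -avg_ssum2; apply: le_trans (sqr_avg_le _ _) _.
    by apply: avg_le => u _; rewrite real_normK ?num_real.
  rewrite avg_sum; apply: ler_sum => l _; rewrite /rowc.
  case: ifPn => _; last by rewrite expr0n/= avg_cst.
  rewrite exprMn sqr_sqrtr; last by apply: sumr_ge0 => k _; exact: sqr_ge0.
  rewrite -(avg_ssum2 n (a^~ l)) le_eqVlt; apply/orP; left; apply/eqP.
  transitivity (avg n (fun s => f l t ^+ 2 * b s l ^+ 2 + 0 * 1)).
    by apply: eq_avg => s _; rewrite exprMn mulrC mul0r addr0.
  by rewrite avg_lin mul0r addr0 mulrC.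
rewrite ler_pM2l//.
apply: (@le_trans _ _ (snorm N f (fun l => (\sum_(k < n) `|a k l| `^ p) `^ p^-1) M)).
  apply: (snorm_le fi Hu) => l _ _; rewrite !ger0_norm ?sqrtr_ge0 ?powR_ge0//.
  exact: (sqrt_sum_sqr_le n (a^~ l)).
apply: le_trans (pc M (fun k : 'I_n => a k)) _.
by apply: ler_wpM2r; [exact: powR_ge0|exact: ler_norm].
Qed.

End maximal_estimate.

(** * The change of density *)

Section greedy.
Context {R : realType}.
Variables (N : option nat) (f : nat -> R -> R) (p K : R).
Hypothesis fi : forall i, inN N i -> isL1 (f i).
Hypothesis Hu : one_unconditional N f.
Hypothesis p1 : 1 < p.
Hypothesis p2 : p <= 2.
Hypothesis pc : p_convex N f p K.

Let p0 : 0 < p. Proof. exact: lt_trans ltr01 p1. Qed.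

Let vec := ((nat -> R) * nat)%type.
Definition vfun (q : vec) : R -> R := psum N q.1 f q.2.
Definition gmax (A : seq vec) (t : R) : R := \big[Num.max/0]_(q <- A) `|vfun q t|.
Definition cost (A : seq vec) : R := \sum_(q <- A) L1norm (vfun q) `^ p.
Definition gain (A : seq vec) : R := L1norm (gmax A) - cost A.

Lemma isL1_vfun q : isL1 (vfun q). Proof. exact: isL1_psum. Qed.

Lemma gmax_ge0 A t : 0 <= gmax A t.
Proof.
by rewrite /gmax; elim: A => [|q A IH]; rewrite ?big_nil ?big_cons// le_max IH orbT.
Qed.

Lemma isL1_gmax A : isL1 (gmax A).
Proof.
elim: A => [|q A IH]; first by apply: eq_isL1 isL10 => t; rewrite /gmax big_nil.
apply: eq_isL1 (isL1_maxr (isL1_abs (isL1_vfun q)) IH) => t.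
by rewrite /gmax big_cons.
Qed.

Lemma gmax_cons q A t : gmax (q :: A) t = Num.max `|vfun q t| (gmax A t).
Proof. by rewrite /gmax big_cons. Qed.

Lemma gmax_seq1 q t : gmax [:: q] t = `|vfun q t|.
Proof. by rewrite gmax_cons /gmax big_nil max_l. Qed.

Lemma gmax_cat A B t : gmax (A ++ B) t = Num.max (gmax A t) (gmax B t).
Proof.
elim: A => [|q A IH]; first by rewrite /= {2}/gmax big_nil max_r ?gmax_ge0.
by rewrite cat_cons !gmax_cons IH maxA.
Qed.

Lemma cost_ge0 A : 0 <= cost A.
Proof. by apply: sumr_ge0 => q _; exact: powR_ge0. Qed.

Lemma psum_trunc (c : nat -> R) m M : (m <= M)%N ->
  psum N (fun l => if (l < m)%N then c l else 0) f M = psum N c f m.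
Proof.
move=> mM; set c' := fun l => _.
have -> : psum N c f m = psum N c' f m.
  by apply: eq_psum => i im _; rewrite /c' im.
apply/funext => t; apply/eqP; rewrite -subr_eq0; apply/eqP.
have := @psum_tail _ N f c' m M mM; move=> /(congr1 (@^~ t)) /= ->.
rewrite /psum big1// => i _; rewrite /c'; case: ltnP; rewrite ?mul0r//.
Qed.

Definition max_const : R := 2 * `|K| + 1.

(** The vectors are padded with zeros to the common length [M], the sum of their lengths. The
    maximum of their moduli lies below the average over signs, as [maximal_estimate] demands. *)
Lemma gmax_le_cost A : L1norm (gmax A) <= max_const * cost A `^ p^-1.
Proof.
pose q0 : vec := (fun=> 0, 0%N).
pose M := (\sum_(q <- A) q.2)%N.
pose a k l := if (l < (nth q0 A k).2)%N then (nth q0 A k).1 l else 0.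
have aE k : (k < size A)%N -> psum N (a k) f M = vfun (nth q0 A k).
  move=> kA; rewrite /a psum_trunc// /M (big_nth q0) big_mkord.
  by rewrite (bigD1 (Ordinal kA))//= leq_addr.
have := @maximal_estimate _ N f p K fi Hu p1 p2 pc (size A) M a (gmax A) (isL1_gmax A).
have -> : \sum_(k < size A) snorm N f (a k) M `^ p = cost A.
  rewrite /cost (big_nth q0) big_mkord; apply: eq_bigr => k _.
  by rewrite /snorm aE.
move=> H; apply: le_trans (H _) _; last first.
  rewrite mulrA; apply: ler_wpM2r; first exact: powR_ge0.
  by rewrite /max_const lerDl.
move=> t; rewrite ger0_norm ?gmax_ge0//.
have avg0 : 0 <= avg (size A) (fun s => `|\sum_(k < size A) s k * psum N (a k) f M t|).
  exact: avg_ge0.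
rewrite /gmax (big_nth q0) big_mkord.
apply: (big_ind (fun x => x <= _)) => // [x y xb yb|k _]; first by rewrite ge_max xb.
rewrite -(aE k)//; exact: (@le_avg_ssum _ (size A) (fun k => psum N (a k) f M t) k).
Qed.

(** For C = [max_const], the relation cost <= C cost^(1/p) forces cost <= C^(p/(p-1)); inserting
    this into C cost^(1/p) gives the formula. *)
Definition gain_const : R := max_const * (max_const `^ (p / (p - 1))) `^ p^-1.

Let C0 : 0 < max_const. Proof. by rewrite ltr_wpDl ?mulr_ge0. Qed.

Lemma gain_const_ge0 : 0 <= gain_const.
Proof. by rewrite mulr_ge0 ?powR_ge0// ltW. Qed.

Lemma gain_ge0_le A : 0 <= gain A -> L1norm (gmax A) <= gain_const.
Proof.
rewrite subr_ge0 => cg; have g := gmax_le_cost A.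
apply: le_trans g _; rewrite ler_pM2l//.
apply: ler_powR2r; rewrite ?invr_ge0 ?(ltW p0) ?cost_ge0//.
have [->|cn0] := eqVneq (cost A) 0; first exact: powR_ge0.
have cp : 0 < cost A by rewrite lt_neqAle eq_sym cn0 cost_ge0.
have h : cost A `^ (1 - p^-1) <= max_const.
  have -> : cost A `^ (1 - p^-1) = cost A / cost A `^ p^-1.
    by rewrite powRB ?cn0 ?implybT// powRr1// ltW.
  rewrite ler_pdivrMr ?powR_gt0//.
  exact: le_trans cg (gmax_le_cost A).
have q0 : 0 < p / (p - 1) by rewrite divr_gt0// subr_gt0.
have -> : cost A = (cost A `^ (1 - p^-1)) `^ (p / (p - 1)).
  rewrite -powRrM (_ : _ * _ = 1) ?powRr1 ?ltW//; field.
  by rewrite !gt_eqF// subr_gt0.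
by apply: ler_powR2r; rewrite ?powR_ge0// ltW.
Qed.

Lemma gain_le A : gain A <= gain_const.
Proof.
have [g0|/ltW g0] := leP 0 (gain A); last exact: le_trans g0 gain_const_ge0.
by apply: le_trans (gain_ge0_le g0); rewrite gerBl cost_ge0.
Qed.

(** Extensions of [A ++ B1] are extensions of [A], and [A ++ B1] nearly attains their supremal gain.
    If its gain is below that of [A], then [A] itself is nearly optimal. *)
Lemma greedy_step A (eps : R) : 0 < eps -> exists A', (exists B, A' = A ++ B) /\
  gain A <= gain A' /\ forall B, gain (A' ++ B) <= gain A' + eps.
Proof.
move=> eps0; pose S := [set gain (A ++ B) | B in [set: seq vec]].
have hS : has_sup S.
  by split; [exists (gain (A ++ [::])), [::]|exists gain_const => _ [B _ <-]; exact: gain_le].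
have ub B : gain (A ++ B) <= sup S by apply: ub_le_sup; [case: hS|exists B].
have [_ [B1 _ <-] hB1] := sup_adherent eps0 hS.
have [gB|gB] := leP (gain A) (gain (A ++ B1)).
  exists (A ++ B1); split; first by exists B1.
  split=> // B; rewrite -catA; apply: le_trans (ub _) _.
  by rewrite -lerBlDr ltW.
exists A; split; first by exists [::]; rewrite cats0.
split=> // B; apply: le_trans (ub _) _; rewrite -lerBlDr ltW//.
exact: lt_trans gB.
Qed.

Definition excess (x g : R -> R) (t : R) : R := Num.max (`|x t| - g t) 0.

Lemma isL1_excess x g : isL1 x -> isL1 g -> isL1 (excess x g).
Proof. by move=> xi gi; apply: isL1_maxr isL10; exact: isL1B (isL1_abs xi) gi. Qed.

Lemma L1norm_subE (g h : R -> R) : isL1 g -> isL1 h -> (forall t, 0 <= g t <= h t) ->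
  L1norm (h \- g) = L1norm h - L1norm g.
Proof.
move=> gi hi gh; have mI := @measurable_I01 R.
rewrite !L1normE -RintegralB//; [|exact: isL1_norm..].
apply: eq_Rintegral => t _ /=; have /andP[g0 gh'] := gh t.
by rewrite !ger0_norm ?subr_ge0// (le_trans g0).
Qed.

Lemma excess_gain A q :
  L1norm (excess (vfun q) (gmax A)) =
  gain (A ++ [:: q]) - gain A + L1norm (vfun q) `^ p.
Proof.
have -> : excess (vfun q) (gmax A) = gmax (A ++ [:: q]) \- gmax A.
  apply/funext => t; rewrite /excess /= gmax_cat gmax_seq1.
  by rewrite addr_maxl subrr maxC.
rewrite L1norm_subE; [|exact: isL1_gmax..|]; last first.
  by move=> t; rewrite gmax_ge0 gmax_cat le_max lexx.
rewrite /gain /cost big_cat big_seq1 /=; ring.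
Qed.

(** The excess is Lipschitz in both arguments, so its bounds pass from the greedy maxima to [G] and
    from partial sums to their limits. *)
Lemma excess_cont (x y g h : R -> R) : isL1 x -> isL1 y -> isL1 g -> isL1 h ->
  L1norm (excess x g) <= L1norm (excess y h) + L1norm (x \- y) + L1norm (g \- h).
Proof.
move=> xi yi gi hi.
have ei := isL1_excess xi gi; have ei' := isL1_excess yi hi.
have di := isL1_abs (isL1B xi yi); have di' := isL1_abs (isL1B gi hi).
apply: (@le_trans _ _ (L1norm (fun t => excess y h t + `|(x \- y) t| + `|(g \- h) t|))).
  apply: L1norm_le => // [|t _]; first exact: isL1D (isL1D ei' di) di'.
  have e0 u v s : 0 <= excess u v s by rewrite /excess le_max lexx orbT.
  rewrite [leLHS]ger0_norm// [leRHS]ger0_norm ?addr_ge0//.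
  rewrite {1}/excess ge_max !addr_ge0// andbT /=.
  have h1 : `|x t| <= `|y t| + `|x t - y t|.
    by apply: le_trans (ler_normD _ _); rewrite addrC subrK.
  have h2 : h t - g t <= `|g t - h t| by rewrite distrC ler_norm.
  have h3 : `|y t| - h t <= excess y h t by rewrite /excess le_max lexx.
  lra.
apply: le_trans (L1normD (isL1D ei' di) di') _; rewrite (L1norm_abs (g \- h)) lerD2r.
by apply: le_trans (L1normD ei' di) _; rewrite (L1norm_abs (x \- y)).
Qed.

(** The families are nested and the n-th step is optimal up to 2^-n, so the excess bound becomes
    exact in the limit. With [nu] strictly above ||x||, the partial sums eventually have norm below
    [nu]. *)
Lemma greedy_density : exists G : R -> R,
  [/\ isL1 G, L1norm G <= gain_const & forall (c : nat -> R) (x : R -> R) (nu : R),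
    L1cvg (psum N c f) x -> L1norm x < nu -> L1norm (excess x G) <= nu `^ p].
Proof.
have e0 (n : nat) : 0 < (2^-1 : R) ^+ n by rewrite exprn_gt0.
have /choice[st stP] : forall An : seq vec * nat, exists A', (exists B, A' = An.1 ++ B) /\
    gain An.1 <= gain A' /\ forall B, gain (A' ++ B) <= gain A' + 2^-1 ^+ An.2.
  by move=> [A n]; apply: greedy_step.
pose fix A n := if n is n'.+1 then st (A n', n') else [::].
pose g n := gmax (A n).
have gi n : isL1 (g n) by exact: isL1_gmax.
have gainA n : 0 <= gain (A n).
  elim: n => [|n IH]; last first.
    by have [_ [h _]] := stP (A n, n); exact: le_trans IH h.
  by rewrite /gain /cost big_nil subr0 L1norm_ge0.
have gS n t : g n t <= g n.+1 t.
  have [[B AB] _] := stP (A n, n).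
  by rewrite /g /= AB gmax_cat le_max lexx.
have gmono m n t : (m <= n)%N -> g m t <= g n t.
  move=> mn; apply: (homo_leq (r := fun a b => a t <= b t) (f := g)) mn => //.
  by move=> a b c; exact: le_trans.
pose I n := L1norm (g n).
have Imono : nondecreasing_seq I.
  move=> m n mn; apply: L1norm_le => // t _.
  by rewrite !ger0_norm ?gmax_ge0// gmono.
(* For nested nonnegative functions L1 distances are differences of norms, so the bounded increasing
   norms make [g] Cauchy. *)
have gsub m n : (m <= n)%N -> L1norm (g n \- g m) = I n - I m.
  by move=> mn; apply: L1norm_subE => // t; rewrite gmax_ge0 gmono.
have Iub n : I n <= gain_const by exact: gain_ge0_le.
have Icv : I @ \oo --> limn I.
  by apply: nondecreasing_is_cvgn => //; exists gain_const => _ [n _ <-].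
have Ile n : I n <= limn I by apply: nondecreasing_cvgn_le.
have [|G [Gi gG]] := @L1_complete _ g gi.
  move=> eps eps0; move/cvgrPdist_lt : Icv => /(_ _ eps0)[M _ HM].
  have key m n : (M <= m)%N -> (m <= n)%N -> L1norm (g n \- g m) < eps.
    move=> Mm mn; rewrite gsub//; have := HM _ Mm => /=.
    rewrite ger0_norm ?subr_ge0//; apply: le_lt_trans.
    by rewrite lerD2r.
  exists M => m n Mm Mn; have [mn|/ltnW nm] := leqP m n; last exact: key.
  by rewrite L1norm_sub key.
exists G; split=> //.
  have := L1cvg_norm gi (conj Gi gG) => /cvgr_to_le; apply; exact: nearW.
have fin q : L1norm (excess (vfun q) G) <= L1norm (vfun q) `^ p.
  have cv : (fun n => L1norm (vfun q) `^ p + (2^-1 ^+ n + L1norm (G \- g n.+1))) @ \oo -->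
      L1norm (vfun q) `^ p.
    rewrite -[X in _ --> X]addr0; apply: cvgD; first exact: cvg_cst.
    rewrite -[X in _ --> X](addr0 0); apply: cvgD.
      by apply: cvg_expr; rewrite ger0_norm ?invf_lt1 ?ltr1n.
    by rewrite (cvg_shiftS (fun n => L1norm (G \- g n))).
  apply: (cvgr_to_ge cv); apply: nearW => n.
  apply: le_trans (excess_cont (isL1_vfun q) (isL1_vfun q) Gi (gi n.+1)) _.
  have -> : L1norm (vfun q \- vfun q) = 0.
    by rewrite (@eq_L1norm _ _ (fun=> 0)) ?L1norm0// => t _ /=; rewrite subrr.
  rewrite addr0 addrA lerD2r (excess_gain (A n.+1)).
  have [_ [_ h]] := stP (A n, n).
  have {h} : gain (A n.+1 ++ [:: q]) <= gain (A n.+1) + 2^-1 ^+ n := h [:: q].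
  lra.
move=> c x nu cx xnu.
have pi n : isL1 (psum N c f n) by exact: isL1_psum.
have cn := L1cvg_norm pi cx.
have [xi cvx] := cx.
have cv : (fun n => nu `^ p + L1norm (x \- psum N c f n)) @ \oo --> nu `^ p.
  by rewrite -[X in _ --> X]addr0; apply: cvgD => //; exact: cvg_cst.
apply: (cvgr_to_ge cv); move/cvgr_lt : cn => /(_ _ xnu); apply: filterS => n pn.
apply: le_trans (excess_cont xi (pi n) Gi Gi) _.
have -> : L1norm (G \- G) = 0.
  by rewrite (@eq_L1norm _ _ (fun=> 0)) ?L1norm0// => t _ /=; rewrite subrr.
rewrite addr0 lerD2r; apply: le_trans (fin (c, n)) _.
by apply: ler_powR2r; [exact: ltW|exact: L1norm_ge0|exact: ltW].
Qed.

End greedy.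

(** * From excess bounds to L_r bounds *)

Section dyadic_bound.
Context {R : realType}.
Local Notation I01 := (`[0%R, 1%R]%classic : set R).
Local Notation lam := (@lebesgue_measure R).
Variables (r p : R).
Hypothesis r1 : 1 <= r.
Hypothesis rp : r < p.

Lemma powR_exprn (x s : R) n : 0 <= x -> (x ^+ n) `^ s = (x `^ s) ^+ n.
Proof.
move=> x0; elim: n => [|n IH]; first by rewrite !expr0 powR1.
by rewrite !exprS powRM ?exprn_ge0// IH.
Qed.

(* The sum over [j] of [2 ^ (r (j + 1)) * 2 ^ (p (1 - j))]. *)
Definition dyadic_const : R := 2 `^ r * 2 `^ p / (1 - 2 `^ r / 2 `^ p).

Let a0 : (0 : R) < 2 `^ r. Proof. exact: powR_gt0. Qed.
Let b0 : (0 : R) < 2 `^ p. Proof. exact: powR_gt0. Qed.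
Let q1 : (2 `^ r / 2 `^ p : R) < 1.
Proof.
rewrite ltr_pdivrMr// mul1r /powR pnatr_eq0/= ltr_expR ltr_pM2r//.
by rewrite ln_gt0// ltr1n.
Qed.

Lemma dyadic_const_ge0 : 0 <= dyadic_const.
Proof. by rewrite divr_ge0 ?mulr_ge0 ?subr_ge0 ?ltW. Qed.

(** A geometric series of ratio 2^(r-p), which is below 1 since r < p. *)
Lemma dyadic_sum_le n :
  \sum_(j < n) (2 `^ r) ^+ j.+1 * (2 * 2^-1 ^+ j) `^ p <= dyadic_const.
Proof.
have -> : \sum_(j < n) (2 `^ r) ^+ j.+1 * (2 * 2^-1 ^+ j) `^ p =
    2 `^ r * 2 `^ p * \sum_(j < n) (2 `^ r / 2 `^ p : R) ^+ j.
  rewrite mulr_sumr; apply: eq_bigr => j _.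
  rewrite powRM ?exprn_ge0// powR_exprn// -[2^-1]powR_inv1// -powRrM mulN1r powRN.
  by rewrite exprS [in RHS]exprMn; ring.
rewrite /dyadic_const ler_pM2l ?mulr_gt0//.
set q := (2 `^ r / 2 `^ p : R).
have q0 : 0 <= q by rewrite divr_ge0// ltW.
rewrite -[leRHS]mul1r ler_pdivlMr ?subr_gt0//.
have := subrX1 q n; rewrite -opprB -[q - 1]opprB mulNr => /oppr_inj E.
by rewrite mulrC -E gerBl exprn_ge0.
Qed.

Lemma dyadic_index (z : R) : 1 <= z -> exists j : nat, 2 ^+ j <= z < 2 ^+ j.+1.
Proof.
move=> z1; have k0 : (0 < Num.truncn z)%N by rewrite truncn_gt0.
exists (trunc_log 2 (Num.truncn z)).
have /andP[h1 h2] := trunc_log_bounds (isT : (1 < 2)%N) k0.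
rewrite -!natrX; apply/andP; split.
  apply: (@le_trans _ _ (Num.truncn z)%:R); first by rewrite ler_nat.
  by rewrite truncn_le (le_trans ler01).
by apply: lt_le_trans (truncnS_gt _) _; rewrite ler_nat.
Qed.

Variables (x W : R -> R) (nu : R).
Hypothesis xi : isL1 x.
Hypothesis Wi : isL1 W.
Hypothesis W1 : forall t, 1 <= W t.
Hypothesis nu0 : 0 < nu.
Let ex j := excess (fun t => 2 * 2^-1 ^+ j / nu * x t) W.
Hypothesis xW : forall j, L1norm (ex j) <= (2 * 2^-1 ^+ j) `^ p.

Let W0 t : 0 < W t. Proof. exact: lt_le_trans ltr01 (W1 t). Qed.
Let ex0 j t : 0 <= ex j t. Proof. by rewrite /ex /excess le_max lexx orbT. Qed.
Let exi j : isL1 (ex j). Proof. by apply: isL1_excess => //; exact: isL1Z. Qed.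

(** Put z = |x| / (nu W). If z < 1, the summand [W t] suffices. If 2^j <= z < 2^(j+1), then z^r <=
    2^(r(j+1)) and 2^(1-j) |x| / nu >= 2 W, so the j-th excess is at least W and the j-th term alone
    suffices. *)
Let dyadic_pointwise t : ((`|x t / W t| `^ r * W t)%:E <=
  (nu `^ r)%:E * ((W t)%:E + \sum_(j <oo) ((2 `^ r) ^+ j.+1 * ex j t)%:E))%E.
Proof.
have r0 : 0 < r by exact: lt_le_trans ltr01 r1.
have term0 j : (0 <= ((2 `^ r) ^+ j.+1 * ex j t)%:E)%E.
  by rewrite lee_fin mulr_ge0// exprn_ge0// ltW.
pose z := `|x t| / nu / W t.
have z0 : 0 <= z by rewrite !divr_ge0// ltW.
have -> : `|x t / W t| = nu * z.
  rewrite normrM normfV (gtr0_norm (W0 t)) /z.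
  by field; rewrite !gt_eqF.
rewrite powRM ?(ltW nu0)// -mulrA EFinM; apply: lee_wpmul2l.
  by rewrite lee_fin powR_ge0.
have [z1|z1] := ltP z 1.
  apply: (@le_trans _ _ (W t)%:E); last by rewrite leeDl// nneseries_ge0.
  rewrite lee_fin ler_piMl ?(ltW (W0 t))//.
  apply: (@le_trans _ _ (1 `^ r)); last by rewrite powR1.
  by rewrite ler_powR2r// ltW.
have [j /andP[zj1 zj2]] := dyadic_index z1.
apply: (@le_trans _ _ (\sum_(0 <= i < j.+1) ((2 `^ r) ^+ i.+1 * ex i t)%:E)%E); last first.
  apply: (@le_trans _ _ (\sum_(i <oo) ((2 `^ r) ^+ i.+1 * ex i t)%:E)%E).
    exact: nneseries_lim_ge.
  by rewrite leeDr// lee_fin ltW.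
rewrite big_nat_recr//=; apply: (@le_trans _ _ ((2 `^ r) ^+ j.+1 * ex j t)%:E); last first.
  by rewrite leeDr// sume_ge0.
rewrite lee_fin; apply: ler_pM; rewrite ?powR_ge0 ?(ltW (W0 t))//.
  by rewrite -powR_exprn// ler_powR2r// ltW.
rewrite /ex /excess le_max; apply/orP; left.
have pj : (0 : R) < 2^-1 ^+ j by rewrite exprn_gt0.
rewrite normrM ger0_norm; last by rewrite divr_ge0 ?mulr_ge0// ltW.
have -> : 2 * 2^-1 ^+ j / nu * `|x t| = 2 * (2^-1 ^+ j * z) * W t.
  by rewrite /z; field; rewrite !gt_eqF.
have h : 1 <= 2^-1 ^+ j * z.
  by rewrite exprVn mulrC ler_pdivlMr ?exprn_gt0// mul1r.
have : W t <= (2^-1 ^+ j * z) * W t by rewrite ler_peMl// ltW.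
lra.
Qed.

Lemma dyadic_bound : (\int[lam]_(t in I01) (`|x t / W t| `^ r * W t)%:E <=
  (nu `^ r * (L1norm W + dyadic_const))%:E)%E.
Proof.
have mI := @measurable_I01 R.
have mx : measurable_fun I01 x by case: xi.
have mW : measurable_fun I01 W by case: Wi.
have mex j : measurable_fun I01 (ex j) by case: (exi j).
have mt j : measurable_fun I01 (fun t => ((2 `^ r) ^+ j.+1 * ex j t)%:E).
  by apply/measurable_EFinP; exact: measurable_funM.
have t0 j t : (0 <= ((2 `^ r) ^+ j.+1 * ex j t)%:E)%E.
  by rewrite lee_fin mulr_ge0// exprn_ge0// ltW.
have ms : measurable_fun I01 (fun t => \sum_(j <oo) ((2 `^ r) ^+ j.+1 * ex j t)%:E)%E.
  apply: (@emeasurable_fun_cvg _ _ _ _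
    (fun n t => \sum_(0 <= j < n) ((2 `^ r) ^+ j.+1 * ex j t)%:E)%E).
    by move=> n; exact: emeasurable_sum.
  move=> t _.
  have : cvgn (fun n => \sum_(0 <= j < n) ((2 `^ r) ^+ j.+1 * ex j t)%:E)%E.
    exact: is_cvg_nneseries.
  exact.
have s0 t : (0 <= \sum_(j <oo) ((2 `^ r) ^+ j.+1 * ex j t)%:E)%E.
  exact: nneseries_ge0.
have mWE : measurable_fun I01 (EFin \o W) by exact/measurable_EFinP.
apply: (@le_trans _ _ (\int[lam]_(t in I01)
    ((nu `^ r)%:E * ((W t)%:E + \sum_(j <oo) ((2 `^ r) ^+ j.+1 * ex j t)%:E)))%E).
  apply: ge0_le_integral => //.
  - by move=> t _; rewrite lee_fin mulr_ge0 ?powR_ge0// ltW.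
  - apply/measurable_EFinP; apply: measurable_funM => //.
    apply: (measurableT_comp (measurable_powR r)); apply: measurableT_comp => //.
    apply: measurable_funM => //.
    rewrite (_ : (fun t => (W t)^-1) = (fun t => W t `^ (-1))).
      exact: (measurableT_comp (measurable_powR (-1)) mW).
    by apply/funext => t; rewrite powR_inv1// ltW.
  - by apply: measurable_funeM; exact: emeasurable_funD.
rewrite ge0_integralZl//; last 3 first.
- exact: emeasurable_funD.
- by move=> t _; rewrite adde_ge0// lee_fin ltW.
- by rewrite lee_fin powR_ge0.
rewrite EFinM; apply: lee_wpmul2l; first by rewrite lee_fin powR_ge0.
rewrite ge0_integralD//; last by move=> t _; rewrite lee_fin ltW.
rewrite EFinD; apply: leeD.
  rewrite EFin_L1norm// le_eqVlt; apply/orP; left; apply/eqP.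
  by apply: eq_integral => t _; rewrite gtr0_norm.
rewrite integral_nneseries//; apply: lime_le.
  by apply: is_cvg_nneseries => j _ _; apply: integral_ge0.
apply: nearW => n; apply: (@le_trans _ _
    (\sum_(0 <= j < n) ((2 `^ r) ^+ j.+1 * (2 * 2^-1 ^+ j) `^ p)%:E)%E); last first.
  by rewrite sumEFin lee_fin big_mkord dyadic_sum_le.
apply: lee_sum => j _; under eq_integral do rewrite EFinM.
have -> : (\int[lam]_(t in I01) (((2 `^ r) ^+ j.+1)%:E * (ex j t)%:E) =
    ((2 `^ r) ^+ j.+1)%:E * \int[lam]_(t in I01) (ex j t)%:E)%E.
  apply: ge0_integralZl => //.
  - by apply/measurable_EFinP; exact: mex.
  - by move=> t _; rewrite lee_fin; exact: ex0.
rewrite EFinM; apply: lee_wpmul2l; first by rewrite lee_fin exprn_ge0// ltW.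
apply: le_trans (_ : (L1norm (ex j))%:E <= _)%E; last by rewrite lee_fin.
rewrite EFin_L1norm// le_eqVlt; apply/orP; left; apply/eqP.
by apply: eq_integral => t _; rewrite ger0_norm.
Qed.

End dyadic_bound.

(** * The embedding of the matrix space *)

Section matrix_space.
Context {R : realType}.
Local Notation I01 := (`[0%R, 1%R]%classic : set R).
Local Notation lam := (@lebesgue_measure R).

Lemma munorm_unif (x : R -> R) : isL1 x -> munorm unif (x \_ I01) = L1norm x.
Proof.
move=> [mx xi]; rewrite /munorm integral_unif//; last first.
  apply/measurable_EFinP; apply: measurableT_comp => //.
  by apply/(measurable_restrictT _ _).1; first exact: measurable_I01.
congr fine; apply: eq_integral => t It; by rewrite patchE It.
Qed.

Lemma L1norm1 : L1norm (fun _ : R => 1 : R) = 1.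
Proof.
rewrite /L1norm; under eq_integral do rewrite normr1.
rewrite integral_cst//= lebesgue_measure_itv/= lte_fin ltr01 -EFinD -EFinM /=.
by rewrite subr0 mulr1.
Qed.

Section rows.
Variables (r p K : R) (N : option nat) (f : nat -> R -> R).
Hypothesis r1 : 1 <= r.
Hypothesis rp : r < p.
Hypothesis p2 : p <= 2.
Hypothesis fi : forall i, inN N i -> isL1 (f i).
Hypothesis Hu : one_unconditional N f.
Hypothesis pc : p_convex N f p K.

(** The first factor bounds the mass of max(G, 0) + 1; the second is what the dyadic bound leaves
    after normalisation of the density. *)
Definition row_const : R := (gain_const p K + 1) * (1 + dyadic_const r p).

Lemma row_const_gt0 : 0 < row_const.
Proof.
have p1 : 1 < p by exact: le_lt_trans rp.
have := gain_const_ge0 p K; have := dyadic_const_ge0 rp => h1 h2.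
by apply: mulr_gt0; [exact: ltr_wpDl|exact: ltr_wpDr].
Qed.

(** The greedy function, raised to be at least 1 and normalised to mass 1, serves all sums of
    F-series at once: the dyadic bound holds for every nu > ||x||, and nu is let down to ||x||. *)
Lemma row_density : exists w : R -> R, [/\ measurable_fun setT w,
  forall t, 0 < w t, (\int[unif]_t (w t)%:E = 1)%E &
  forall c x, L1cvg (psum N c f) x -> density_good r unif w row_const (x \_ I01)].
Proof.
have p1 : 1 < p by exact: le_lt_trans rp.
have r0 : 0 < r by exact: lt_le_trans ltr01 r1.
have mI := @measurable_I01 R.
have [G [Gi GM Gex]] := greedy_density fi Hu p1 p2 pc.
(* Extension by 0 makes [W] measurable on the whole line. The maximum with 0 is there because [G],
   an L1 limit, may be negative at some points. *)
pose W t : R := Num.max ((G \_ I01) t) 0 + 1.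
have W1 t : 1 <= W t by rewrite lerDr le_max lexx orbT.
have W0 t : 0 < W t by exact: lt_le_trans ltr01 (W1 t).
have mG : measurable_fun setT (G \_ I01).
  by apply/(measurable_restrictT _ _).1 => //; case: Gi.
have mW : measurable_fun setT W.
  by apply: measurable_funD => //; exact: measurable_maxr.
have Gi' : isL1 (G \_ I01).
  apply: isL1_le Gi _; first exact: measurable_funTS.
  by move=> t It; rewrite patchE mem_set.
have Wi : isL1 W by apply: isL1D (isL1_maxr Gi' isL10) (isL1_cst 1).
pose m := L1norm W.
have m1 : 1 <= m.
  rewrite -[leLHS]L1norm1.
  by apply: L1norm_le => //; [exact: isL1_cst|move=> t _; rewrite normr1 ger0_norm// ltW].
have m0 : 0 < m by exact: lt_le_trans ltr01 m1.
have mM : m <= gain_const p K + 1.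
  apply: (@le_trans _ _ (L1norm G + L1norm (fun _ : R => 1 : R))).
    rewrite -(L1norm_abs G).
    apply: le_trans (L1normD (isL1_abs Gi) (isL1_cst 1)).
    apply: L1norm_le => //; first exact: isL1D (isL1_abs Gi) (isL1_cst 1).
    move=> t It; rewrite (ger0_norm (ltW (W0 t))) ger0_norm ?addr_ge0// /W lerD2r.
    rewrite patchE mem_set//.
    by rewrite ge_max ler_norm normr_ge0.
  by rewrite L1norm1 lerD2r.
exists (fun t => W t / m); split.
- exact: measurable_funM.
- by move=> t; rewrite divr_gt0.
- rewrite integral_unif; last 2 first.
  + by apply/measurable_EFinP; exact: measurable_funM.
  + by move=> t; rewrite lee_fin divr_ge0// ltW.
  transitivity (m^-1%:E * (L1norm W)%:E)%E; last by rewrite -EFinM mulVf// gt_eqF.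
  rewrite EFin_L1norm// -ge0_integralZl//; last 2 first.
  + apply/measurable_EFinP; apply: measurableT_comp => //; exact: measurable_funTS.
  + by rewrite lee_fin invr_ge0 ltW.
  by apply: eq_integral => t _; rewrite gtr0_norm// mulrC EFinM.
move=> c x cx; have [xi _] := cx; have [mx xint] := xi.
have mx' : measurable_fun setT (x \_ I01).
  by apply/(measurable_restrictT _ _).1.
have mWV : measurable_fun setT (fun t => (W t)^-1).
  rewrite (_ : (fun t => (W t)^-1) = (fun t => W t `^ (-1))).
    exact: (measurableT_comp (measurable_powR (-1)) mW).
  by apply/funext => t; rewrite powR_inv1// ltW.
have dc0 := dyadic_const_ge0 rp.
have bound nu : L1norm x < nu -> (\int[lam]_(t in I01) (`|x t / W t| `^ r * W t)%:E <=
    (nu `^ r * (m + dyadic_const r p))%:E)%E.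
  move=> xnu; have nu0 : 0 < nu by exact: le_lt_trans (L1norm_ge0 x) xnu.
  apply: dyadic_bound => // j; set de := 2 * 2^-1 ^+ j / nu.
  have de0 : 0 < de by rewrite divr_gt0// mulr_gt0// exprn_gt0.
  have dx : L1cvg (psum N (fun i => de * c i) f) (fun t => de * x t).
    have := L1cvg_lin de 0 (fun n => isL1_psum fi c n) (fun n => isL1_psum fi c n) cx cx.
    congr L1cvg; first by apply/funext => n; apply/funext => t; rewrite psumZ mul0r addr0.
    by apply/funext => t; rewrite mul0r addr0.
  have dnu : L1norm (fun t => de * x t) < 2 * 2^-1 ^+ j.
    rewrite L1normZ// gtr0_norm//.
    have -> : 2 * 2^-1 ^+ j = de * nu by rewrite /de divfK// gt_eqF.
    by rewrite ltr_pM2l.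
  apply: le_trans (Gex _ _ _ dx dnu).
  apply: L1norm_le; [by apply: isL1_excess => //; exact: isL1Z..|].
  move=> t It.
  have e0 u v s : 0 <= excess u v s :> R by rewrite /excess le_max lexx orbT.
  rewrite !ger0_norm// [leLHS]/excess ge_max e0 andbT /excess le_max.
  apply/orP; left; rewrite lerD2l lerN2 /W patchE mem_set//.
  by apply: (@le_trans _ _ (Num.max (G t) 0)); [rewrite le_max lexx|rewrite lerDl].
split => //.
  have : unif.-integrable setT (EFin \o (x \_ I01)).
    apply/integrableP; split; first exact/measurable_EFinP.
    rewrite integral_unif//; last by apply: measurableT_comp => //; exact/measurable_EFinP.
    have := ltry (L1norm x); rewrite EFin_L1norm//; congr (_ < _)%E.
    by apply: eq_integral => t It; rewrite /= patchE It.
  exact.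
rewrite munorm_unif//.
(* Passing from W to W / m multiplies the quotient by m and the measure by 1/m, whence the factor
   m^r / m. *)
have -> : (\int[unif]_t (`|(x \_ I01) t / (W t / m)| `^ r * (W t / m))%:E =
    (m `^ r / m)%:E * \int[lam]_(t in I01) (`|x t / W t| `^ r * W t)%:E)%E.
  rewrite integral_unif; last 2 first.
  - apply/measurable_EFinP; apply: measurable_funM; last exact: measurable_funM.
    apply: (measurableT_comp (measurable_powR r)); apply: measurableT_comp => //.
    apply: measurable_funM => //.
    rewrite (_ : (fun t => (W t / m)^-1) = (fun t => (W t)^-1 * m)).
      exact: measurable_funM.
    by apply/funext => t; rewrite invfM invrK.
  - by move=> t; rewrite lee_fin mulr_ge0 ?powR_ge0// divr_ge0// ltW.
  rewrite -ge0_integralZl//; last 3 first.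
  - apply/measurable_EFinP; apply: measurable_funM; last exact: measurable_funTS.
    apply: (measurableT_comp (measurable_powR r)); apply: measurableT_comp => //.
    by apply: measurable_funM => //; exact: measurable_funTS.
  - by move=> t _; rewrite lee_fin mulr_ge0 ?powR_ge0// ltW.
  - by rewrite lee_fin divr_ge0 ?powR_ge0// ltW.
  apply: eq_integral => t It; rewrite -EFinM patchE It; congr (_%:E).
  have -> : `|x t / (W t / m)| = m * `|x t / W t|.
    by rewrite invfM invrK mulrA normrM (gtr0_norm m0) mulrC.
  rewrite powRM ?(ltW m0)//; ring.
set J := (\int[lam]_(t in I01) _)%E.
have J0 : (0 <= J)%E.
  by apply: integral_ge0 => t _; rewrite lee_fin mulr_ge0 ?powR_ge0// ltW.
have [j Jj] : exists j, J = j%:E.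
  exists (fine J); rewrite fineK// ge0_fin_numE//.
  by apply: le_lt_trans (bound (L1norm x + 1) _) (ltry _); rewrite ltrDl.
rewrite Jj -EFinM lee_fin; rewrite Jj lee_fin in J0.
have L0 := row_const_gt0.
have i0 : 0 <= m `^ r / m * j by rewrite mulr_ge0// divr_ge0 ?powR_ge0// ltW.
rewrite -[leLHS](@powRVK _ r) ?gt_eqF//.
apply: ler_powR2r; rewrite ?(ltW r0) ?powR_ge0//.
(* The dyadic bound requires nu > ||x||; dividing by [row_const] isolates the norm, to which an
   arbitrary eps can then be added. *)
rewrite [leRHS]mulrC -ler_pdivrMr//; apply/ler_addgt0Pr => eps eps0.
rewrite ler_pdivrMr//; set nu := L1norm x + eps.
have xnu : L1norm x < nu by rewrite ltrDl.
have nu0 : 0 < nu by exact: le_lt_trans (L1norm_ge0 x) xnu.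
have nuL0 : 0 <= nu * row_const by exact: mulr_ge0 (ltW nu0) (ltW L0).
rewrite -[leRHS](@powRKV _ r) ?gt_eqF//.
apply: ler_powR2r; rewrite ?invr_ge0 ?(ltW r0)//.
have := bound nu xnu; rewrite -/J Jj lee_fin => jb.
apply: (@le_trans _ _ (m `^ r / m * (nu `^ r * (m + dyadic_const r p)))).
  by apply: ler_wpM2l => //; rewrite divr_ge0 ?powR_ge0// ltW.
have -> : m `^ r / m * (nu `^ r * (m + dyadic_const r p)) =
    (nu * m) `^ r * (1 + dyadic_const r p / m).
  by rewrite powRM ?(ltW nu0) ?(ltW m0)//; field; rewrite gt_eqF.
(* With D = [dyadic_const r p], 1 + D/m <= 1 + D <= (1 + D)^r because m >= 1 and r >= 1; everything
   is now an r-th power. *)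
apply: (@le_trans _ _ ((nu * m) `^ r * (1 + dyadic_const r p) `^ r)).
  apply: ler_wpM2l; first exact: powR_ge0.
  apply: (@le_trans _ _ (1 + dyadic_const r p)).
    by rewrite lerD2l ler_pdivrMr// ler_peMr.
  rewrite -[leLHS]powRr1; last by rewrite addr_ge0.
  by apply: ler_powR => //; rewrite lerDl.
have nm0 : 0 <= nu * m by rewrite mulr_ge0// ltW.
have d0 : 0 <= 1 + dyadic_const r p by rewrite addr_ge0.
rewrite -(powRM _ nm0 d0); apply: ler_powR2r; [exact: ltW|exact: mulr_ge0|].
by rewrite /row_const -mulrA ler_pM2l//; exact: ler_wpM2r.
Qed.

End rows.

(** The coordinates of a matrix are the sums of its rows in L1. A single density serves all rows, so
    the tensor lemma applies with the uniform probability as [mu]. *)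
Lemma matrix_embeds (r p K1 K2 : R) (NE : option nat) (e : nat -> R -> R)
    (NF : option nat) (f : nat -> R -> R) : 1 <= r -> r < p -> p <= 2 ->
  (forall i, inN NE i -> isL1 (e i)) -> one_unconditional NE e -> r_concave NE e r K1 ->
  (forall i, inN NF i -> isL1 (f i)) -> one_unconditional NF f -> p_convex NF f p K2 ->
  embeds_L1 (in_EF NE e NF f) (@lin_mat R) (EF_norm NE e NF f)
    (`|K1| * row_const r p K2 + 1).
Proof.
move=> r1 rp p2 ei Eu rc fi Fu pc.
have [w [mw w0 w1 wP]] := row_density r1 rp p2 fi Fu pc.
have fp c n : isL1 (psum NF c f n) by exact: isL1_psum.
pose rows (A : nat -> nat -> R) k : R -> R :=
  xget (fun=> 0) [set x | L1cvg (psum NF (A k) f) x].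
have rowsP A k : (exists x, L1cvg (psum NF (A k) f) x) ->
    L1cvg (psum NF (A k) f) (rows A k).
  by move=> [x Ax]; rewrite /rows; case: xgetP => [y _ //|/(_ x)].
have rowsS A : in_EF NE e NF f A -> forall k, inN NE k ->
    L1cvg (psum NF (A k) f) (rows A k).
  move=> [_ [v [rw [rwP _]]]] k Nk; apply: rowsP; exists (rw k).
  exact: rwP.
have rlin a A b B k : in_EF NE e NF f A -> in_EF NE e NF f B -> inN NE k ->
    L1cvg (psum NF (lin_mat a A b B k) f) (fun t => a * rows A k t + b * rows B k t).
  move=> SA SB Nk; have := L1cvg_lin a b (fp (A k)) (fp (B k)) (rowsS A SA k Nk) (rowsS B SB k Nk).
  congr L1cvg; apply/funext => n; apply/funext => t; by rewrite -psum_lin.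
have nE A k : L1cvg (psum NF (A k) f) (rows A k) ->
    munorm unif (rows A k \_ I01) = L1norm (rows A k).
  by move=> [ri _]; exact: munorm_unif.
(* The norm of a row sum does not depend on its representative, so the chosen rows and those in the
   definition of the norm give the same coefficients. *)
have normE A rw : in_EF NE e NF f A ->
    (forall k, inN NE k -> series_to NF (A k) f (rw k)) ->
    psum NE (munorm unif \o (fun k => rows A k \_ I01)) e =
    psum NE (fun k => L1norm (rw k)) e.
  move=> SA rwP; apply/funext => n; apply: eq_psum => k _ Nk /=.
  have rk := rowsS A SA k Nk; have rwk : L1cvg (psum NF (A k) f) (rw k) := rwP k Nk.
  rewrite nE//.
  exact: cvg_unique (L1cvg_norm (fp (A k)) rk) (L1cvg_norm (fp (A k)) rwk).
have /ltW L0 := @row_const_gt0 r p K2 r1 rp.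
apply: (@embeds_tens _ NE e r K1 ei Eu r1 rc unif w (row_const r p K2) mw w0 w1 L0 _ _ _ _
  (fun A k => rows A k \_ I01)).
- by move=> A SA k Nk; apply: wP; exact: rowsS.
- move=> a A b B SA SB k Nk.
  have rl := rowsP (lin_mat a A b B) k (ex_intro _ _ (rlin a A b B k SA SB Nk)).
  split; first exact: wP rl.
  (* The defect of linearity is the sum of an F-series with zero coefficients, hence [density_good];
     uniqueness of limits makes its norm 0. *)
  pose z t := 1 * rows (lin_mat a A b B) k t + (-1) * (a * rows A k t + b * rows B k t).
  have zc : L1cvg (psum NF (fun=> 0) f) z.
    have := L1cvg_lin 1 (-1) (fp _) (fp _) rl (rlin a A b B k SA SB Nk).
    congr L1cvg; apply/funext => n; apply/funext => t.
    by rewrite mul1r mulN1r subrr /psum big1// => i _; rewrite mul0r.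
  have -> : (fun t => (rows (lin_mat a A b B) k \_ I01) t -
      (a * (rows A k \_ I01) t + b * (rows B k \_ I01) t)) = z \_ I01.
    apply/funext => t; rewrite !patchE /z; case: ifP => _; first by rewrite mul1r mulN1r.
    by rewrite !mulr0 addr0 subrr.
  split; first exact: wP zc.
  rewrite munorm_unif; last by case: zc.
  have -> : L1norm z = L1norm (rows (lin_mat a A b B) k \-
      (fun t => a * rows A k t + b * rows B k t)).
    by apply: eq_L1norm => t _; rewrite /z /= mul1r mulN1r.
  exact: L1cvg_uniq (fp _) rl (rlin a A b B k SA SB Nk).
- move=> A SA; have [_ [v [rw [rwP [h [hP _]]]]]] := SA; exists h.
  by rewrite (normE A rw SA rwP).
- move=> A c SA [rw [rwP [h [hP ->]]]]; exists h.
  by rewrite (normE A rw SA rwP).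
Qed.

End matrix_space.

Theorem theorem1 (R : realType) :
  (forall r K1 K2 : R, 1 <= r ->
    exists C : R, 0 < C /\
    forall (N : option nat) (e : nat -> R -> R)
           (mu : probability R R) (X : set (R -> R)),
      basic_seq N e -> one_unconditional N e -> r_concave N e r K1 ->
      mu (`[0%R, 1%R]%classic : set R) = 1%E ->
      L1mu_subspace mu X ->
      (forall x, X x -> ('N[mu]_(r%:E)[EFin \o x] <= K2%:E * 'N[mu]_1[EFin \o x])%E) ->
      embeds_L1 (in_sumspace N e mu X) (@lin_seq R) (sumspace_norm N e mu) C)
  /\
  (forall r p K1 K2 : R, 1 <= r -> r < p -> p <= 2 ->
    exists C : R, 0 < C /\
    forall (NE : option nat) (e : nat -> R -> R) (NF : option nat) (f : nat -> R -> R),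
      basic_seq NE e -> one_unconditional NE e -> r_concave NE e r K1 ->
      basic_seq NF f -> one_unconditional NF f -> p_convex NF f p K2 ->
      embeds_L1 (in_EF NE e NF f) (@lin_mat R) (EF_norm NE e NF f) C).
Proof.
split.
- move=> r K1 K2 r1; exists (`|K1| * `|K2| + 1).
  split; first by rewrite ltr_wpDl// mulr_ge0.
  move=> N e mu X [ei _] Hu rc _ XL XK; exact: (@sumspace_embeds R r K1 K2 N e mu X).
- move=> r p K1 K2 r1 rp p2; exists (`|K1| * row_const r p K2 + 1).
  split; first by rewrite ltr_wpDl// mulr_ge0// ltW// row_const_gt0.
  move=> NE e NF f [ei _] Eu rc [fi _] Fu pc; exact: matrix_embeds.
Qed.
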